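(* Let $\phi$ be a $\Xi$-regular Anderson $A$-module of dimension $d$ with abelian $A$-motive $M$ and $A$-finite dual $A$-motive $N$, and let $F$ be the pairing defined in the context. Then for every $\mathbf z\in L^d$, \[F(1,1;\mathbf z)=\mathrm{Exp}_\phi(\mathbf z).\]
   Context: Let $\mathbb{F}_q$ be the finite field with $q$ elements, $X$ a smooth projective geometrically connected curve over $\mathbb{F}_q$ with a fixed rational point $\infty$, $K$ its function field, $A\subset K$ the ring of functions regular away from $\infty$, $K_\infty$ the completion of $K$ at $\infty$, $\mathbb{C}_\infty$ the completion of an algebraic closure of $K_\infty$, and $L$ an algebraically closed field with $K\subseteq L\subseteq\mathbb{C}_\infty$. Tensor products are over $\mathbb{F}_q$; $L\otimes A$ is a domain with fraction field $Q$. For $h=\sum_j\ell_j\otimes f_j$ and $i\in\mathbb{Z}$ put $h^{(i)}=\sum_j\ell_j^{q^i}\otimes f_j$ (extended to $Q$, and entrywise to vectors and matrices; for $v\in\mathbb{C}_\infty^d$, $v^{(i)}$ raises each entry to the $q^i$-th power). $(L\otimes A)[\tau]$ is the skew polynomial ring with $\tau h=h^{(1)}\tau$, and $(L\otimes A)[\sigma]$ the one with $\sigma h=h^{(-1)}\sigma$; $L$ and $A$ are identified with $L\otimes1$ and $1\otimes A$. For $i\in\mathbb{Z}$ let $J^{(i)}\subset L\otimes A$ be the ideal generated by all $1\otimes a-a^{q^i}\otimes1$ ($a\in A$), $J=J^{(0)}$; an element of $Q$ is regular at $\Xi^{(i)}$ if it lies in $(L\otimes A)_{J^{(i)}}$.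 An Anderson $A$-module of dimension $d$ is an $\mathbb{F}_q$-algebra homomorphism $\phi:A\to\mathrm{Mat}_d(L)[\tau]$, $\phi_a=d[a]+\sum_{i\ge1}A_{a,i}\tau^i$, with $d[a]=aI_d+N_a$, $N_a$ nilpotent; $\tau$ acts on $\mathbb{C}_\infty^d$ by raising entries to the $q$-th power. Its exponential $\mathrm{Exp}_\phi(\mathbf z)=\sum_{i\ge0}Q_i\mathbf z^{(i)}$ is the unique $\mathbb{F}_q$-linear power series with $Q_i\in\mathrm{Mat}_d(\mathbb{C}_\infty)$, $Q_0=I_d$, and $\mathrm{Exp}_\phi(d[a]\mathbf z)=\phi_a(\mathrm{Exp}_\phi(\mathbf z))$ for all $a\in A$; it is entire on $\mathbb{C}_\infty^d$. For $\beta=\sum_iB_i\tau^i\in\mathrm{Mat}_d(L)[\tau]$ put $\beta^*=\sum_i(B_i^\top)^{(-i)}\sigma^i$. Let $M=\mathrm{Mat}_{1\times d}(L[\tau])$ with $a\cdot m=m\phi_a$, $\ell\cdot m=\ell m$, $\tau\cdot m=\tau m$, and $N=\mathrm{Mat}_{1\times d}(L[\sigma])$ with $a\cdot n=n\phi_a^*$, $\ell\cdot n=\ell n$, $\sigma\cdot n=\sigma n$ ($a\in A,\ell\in L$). Standing assumption: $M$ and $N$ are finitely generated projective $L\otimes A$-modules of constant rank $r$ with $J^nM\subseteq\tau M$, $J^nN\subseteq\sigma N$ for $n$ large. Let $g_1,\dots,g_d$ (resp. $h_1,\dots,h_d$) be the standard basis row vectors of $M$ over $L[\tau]$ (resp.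 $N$ over $L[\sigma]$). For $m=\sum_k\sum_{j\ge0}c_{k,j}\tau^jg_k\in M$ let $\delta_0^M(m)=(c_{1,0},\dots,c_{d,0})^\top$; for $n=\sum_k\sum_{j\ge0}c_{k,j}\sigma^jh_k\in N$ let $\delta_1^N(n)=\sum_j(c_{1,j}^{q^j},\dots,c_{d,j}^{q^j})^\top$. Since $\delta_0^M$ vanishes on $\tau M\supseteq J^nM$, it factors through $M/J^nM\cong M_J/J^nM_J$ and extends to $M_J=M\otimes_{L\otimes A}(L\otimes A)_J$. On $M_Q=M\otimes_{L\otimes A}Q$, $\tau(m\otimes f)=\tau m\otimes f^{(1)}$ is bijective with inverse $\tau^{-1}$. $\phi$ is $\Xi$-regular if there is an $L\otimes K$-basis $c_1,\dots,c_r$ of $M\otimes_AK$ and $\Phi\in\mathrm{Mat}_r(L\otimes K)$ with $\tau(c_1,\dots,c_r)^\top=\Phi(c_1,\dots,c_r)^\top$, $\det\Phi$ and all entries of $\Phi$ regular at every $\Xi^{(i)}$, $i\in\mathbb{Z}$; then $\tau^{-i}(m)\in M_J$ for $m\in M$, $i\ge0$. $N[[\sigma]]$ is the set of formal sums $\sum_k\sum_{j\ge0}c_{k,j}\sigma^jh_k$ with $(c_{1,j},\dots,c_{d,j})^{(j)}\to0$ in $\mathbb{C}_\infty^d$; $\delta_1^N$ extends to it by the same (now convergent) formula. For $x\in(L\otimes A)[\tau]$, $y\in(L\otimes A)[\sigma]$, $\mathbf z\in L^d$, \[F(x,y;\mathbf z)=\delta_1^N\Big(\sum_{i=0}^\infty\sum_{k=1}^d\big(\delta_0^M(\tau^{-i}(x\cdot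 g_k))^\top\mathbf z\big)\,\sigma^i(y\cdot h_k)\Big),\] the inner series lying in $N[[\sigma]]$. *)

(* Defs.v *)
From HB Require Import structures.
From mathcomp Require Import all_boot all_order all_algebra all_field abelian pgroup.
From mathcomp Require Import generic_quotient ring_quotient.
From mathcomp Require Import boolp classical_sets reals.

Set Implicit Arguments.
Unset Strict Implicit.
Unset Printing Implicit Defensive.

Import Order.TTheory GRing.Theory Num.Theory.

Local Open Scope quotient_scope.
Local Open Scope classical_set_scope.
Local Open Scope ring_scope.

Section Tensor.
Context {S : Type} {U V : zmodType} (aU : S -> U -> U) (aV : S -> V -> V).

Definition balanced (W : zmodType) (b : U -> V -> W) : Prop :=
  [/\ forall v, {morph b^~ v : x y / x + y},
      forall u, {morph b u : x y / x + y}
    & forall s u v, b (aU s u) v = b u (aV s v)].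

Definition tensor_eval (W : zmodType) (b : U -> V -> W) (x : seq (U * V)) : W :=
  \sum_(p <- x) b p.1 p.2.

(* Two formal sums of pairs are identified when no balanced biadditive map *)
(* separates them; this makes the quotient the tensor product over [S].    *)
Definition tensor_rel (x y : seq (U * V)) : bool :=
  `[< forall (W : zmodType) (b : U -> V -> W),
        balanced b -> tensor_eval b x = tensor_eval b y >].

Lemma tensor_relP x y :
  reflect (forall (W : zmodType) (b : U -> V -> W),
             balanced b -> tensor_eval b x = tensor_eval b y) (tensor_rel x y).
Proof. exact: asboolP. Qed.

Lemma tensor_rel_equiv : equiv_class_of tensor_rel.
Proof.
split=> [x|x y|y x z].
- exact/tensor_relP.
- by apply/tensor_relP/tensor_relP => h W b hb; rewrite (h _ b hb).
- move=> /tensor_relP h1 /tensor_relP h2; apply/tensor_relP => W b hb.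
  by rewrite (h1 _ b hb) (h2 _ b hb).
Qed.

Canonical tensor_equiv := EquivRelPack tensor_rel_equiv.

Definition tensor : Type := {eq_quot tensor_rel}.
HB.instance Definition _ := Choice.on tensor.
HB.instance Definition _ := EqQuotient.on tensor.

Definition tensor_add (x y : tensor) : tensor := \pi_tensor (repr x ++ repr y).
Definition tensor_opp (x : tensor) : tensor :=
  \pi_tensor [seq (- p.1, p.2) | p <- repr x].
Definition tensor_zero : tensor := \pi_tensor [::].
Definition tensor_pure (u : U) (v : V) : tensor := \pi_tensor [:: (u, v)].

Definition tensor_lift (W : zmodType) (b : U -> V -> W) (x : tensor) : W :=
  tensor_eval b (repr x).

Section Lift.
Context (W : zmodType) (b : U -> V -> W) (hb : balanced b).

Lemma tensor_lift_pi x : tensor_lift b (\pi_tensor x) = tensor_eval b x.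
Proof.
have /eqmodP /tensor_relP h : repr (\pi_tensor x) = x %[mod tensor] by rewrite reprK.
exact: h.
Qed.

Lemma tensor_lift_pure u v : tensor_lift b (tensor_pure u v) = b u v.
Proof. by rewrite tensor_lift_pi /tensor_eval big_seq1. Qed.

Lemma tensor_lift_add x y :
  tensor_lift b (tensor_add x y) = tensor_lift b x + tensor_lift b y.
Proof. by rewrite tensor_lift_pi /tensor_eval big_cat. Qed.

Lemma tensor_lift_zero : tensor_lift b tensor_zero = 0.
Proof. by rewrite tensor_lift_pi /tensor_eval big_nil. Qed.

Lemma tensor_lift_opp x : tensor_lift b (tensor_opp x) = - tensor_lift b x.
Proof.
have [b1 _ _] := hb.
have b0 v : b 0 v = 0 by apply: (addrI (b 0 v)); rewrite -b1 !addr0.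
rewrite tensor_lift_pi /tensor_lift /tensor_eval big_map /= -sumrN.
apply: eq_bigr => p _; apply: (addIr (b p.1 p.2)).
by rewrite -b1 !addNr b0.
Qed.

End Lift.

Lemma tensor_sep (x y : tensor) :
  (forall (W : zmodType) (b : U -> V -> W), balanced b ->
     tensor_lift b x = tensor_lift b y) -> x = y.
Proof.
move=> h; rewrite -[x]reprK -[y]reprK; apply/eqmodP/tensor_relP => W b hb.
exact: h.
Qed.

Fact tensor_addA : associative tensor_add.
Proof. by move=> x y z; apply: tensor_sep => W b hb; rewrite !tensor_lift_add ?addrA. Qed.
Fact tensor_addC : commutative tensor_add.
Proof. by move=> x y; apply: tensor_sep => W b hb; rewrite !tensor_lift_add // addrC. Qed.
Fact tensor_add0 : left_id tensor_zero tensor_add.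
Proof.
move=> x; apply: tensor_sep => W b hb.
by rewrite tensor_lift_add // tensor_lift_zero // add0r.
Qed.
Fact tensor_addN : left_inverse tensor_zero tensor_opp tensor_add.
Proof.
move=> x; apply: tensor_sep => W b hb.
by rewrite tensor_lift_add // tensor_lift_opp // tensor_lift_zero // addNr.
Qed.

HB.instance Definition _ :=
  GRing.isZmodule.Build tensor tensor_addA tensor_addC tensor_add0 tensor_addN.

Lemma tensor_liftD (W : zmodType) (b : U -> V -> W) (hb : balanced b) :
  {morph tensor_lift b : x y / x + y}.
Proof. exact: tensor_lift_add. Qed.

Lemma tensor_pure_balanced : balanced tensor_pure.
Proof.
split=> [v x y|u x y|s u v]; apply: tensor_sep => W b hb; have [b1 b2 b3] := hb.
- by rewrite [RHS](tensor_lift_add hb) !(tensor_lift_pure hb); exact: b1.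
- by rewrite [RHS](tensor_lift_add hb) !(tensor_lift_pure hb); exact: b2.
- by rewrite !(tensor_lift_pure hb); exact: b3.
Qed.

Lemma tensor_ind (P : tensor -> Prop) :
  P 0 -> (forall u v, P (tensor_pure u v)) ->
  (forall x y, P x -> P y -> P (x + y)) -> forall x, P x.
Proof.
move=> P0 Pp PD x; rewrite -[x]reprK; elim: (repr x) => [//|[u v] s IH].
suff -> : \pi_tensor ((u, v) :: s) = tensor_pure u v + \pi_tensor s by exact: PD.
apply: tensor_sep => W b hb.
by rewrite (tensor_liftD hb) !(tensor_lift_pi hb) /tensor_eval big_cons big_seq1.
Qed.

Lemma tensor_ext (W : zmodType) (f g : tensor -> W) :
  {morph f : x y / x + y} -> {morph g : x y / x + y} ->
  (forall u v, f (tensor_pure u v) = g (tensor_pure u v)) -> f =1 g.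
Proof.
move=> fD gD fg; apply: tensor_ind => // [|x y hx hy]; last by rewrite fD gD hx hy.
have f0 : f 0 = 0 by apply: (addrI (f 0)); rewrite -fD !addr0.
have g0 : g 0 = 0 by apply: (addrI (g 0)); rewrite -gD !addr0.
by rewrite f0 g0.
Qed.

End Tensor.

(* The skew polynomial ring R[t] with t * c = theta c * t; the coefficients *)
(* of [p : skewpoly theta] are written on the left of the powers of t.      *)
Definition skewpoly (R : nzRingType) (theta : {rmorphism R -> R}) : Type :=
  {poly R}.

Section SkewPoly.
Context {R : nzRingType} (theta : {rmorphism R -> R}).
Local Notation sp := (skewpoly theta).

HB.instance Definition _ := GRing.Zmodule.on sp.

Definition skew_coef (p : sp) (i : nat) : R := (p : {poly R})`_i.

Definition skew_mul (p q : sp) : sp :=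
  \poly_(n < (size (p : {poly R}) + size (q : {poly R}))%N)
    \sum_(i < n.+1) skew_coef p i * iter i theta (skew_coef q (n - i)).

Definition skew_one : sp := (1 : {poly R}).

Lemma iter_thetaD i : {morph iter i theta : x y / x + y}.
Proof. by elim: i => [//|i IH] x y /=; rewrite IH rmorphD. Qed.
Lemma iter_thetaM i : {morph iter i theta : x y / x * y}.
Proof. by elim: i => [//|i IH] x y /=; rewrite IH rmorphM. Qed.
Lemma iter_theta0 i : iter i theta 0 = 0.
Proof. by elim: i => [//|i IH] /=; rewrite IH rmorph0. Qed.
Lemma iter_theta1 i : iter i theta 1 = 1.
Proof. by elim: i => [//|i IH] /=; rewrite IH rmorph1. Qed.
Lemma iter_theta_sum i (I : Type) (r : seq I) (P : pred I) (F : I -> R) :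
  iter i theta (\sum_(j <- r | P j) F j) = \sum_(j <- r | P j) iter i theta (F j).
Proof. exact: (big_morph _ (iter_thetaD i) (iter_theta0 i)). Qed.

Lemma skew_coef_mul p q n : skew_coef (skew_mul p q) n =
  \sum_(i < n.+1) skew_coef p i * iter i theta (skew_coef q (n - i)).
Proof.
rewrite {1}/skew_coef coef_poly; case: ltnP => // le_n.
rewrite big1 // => i _; rewrite /skew_coef.
have [lt_i|le_i] := ltnP i (size (p : {poly R})); last by rewrite nth_default // mul0r.
rewrite [X in iter _ _ X]nth_default ?iter_theta0 ?mulr0 //.
rewrite leq_subRL; last by rewrite -ltnS.
by apply: leq_trans le_n; rewrite leq_add2r ltnW.
Qed.

Lemma skew_eqP (p q : sp) : skew_coef p =1 skew_coef q -> p = q.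
Proof. by move=> h; apply/polyP. Qed.

Lemma skew_coefD (p q : sp) n : skew_coef (p + q) n = skew_coef p n + skew_coef q n.
Proof. exact: coefD. Qed.

Fact skew_mulA : associative skew_mul.
Proof.
move=> p q r; apply: skew_eqP => n.
pose G j k := skew_coef p j * iter j theta (skew_coef q (n - j - k)%N) *
                iter (n - k) theta (skew_coef r k).
transitivity (\sum_(j < n.+1) \sum_(k < n.+1 | (k <= n - j)%N) G j k).
  rewrite skew_coef_mul; apply: eq_bigr => j _.
  rewrite skew_coef_mul iter_theta_sum big_distrr /=.
  rewrite (reindex_inj rev_ord_inj) /=.
  rewrite (big_ord_narrow_leq (leq_subr _ _)); apply: eq_bigr => k _ /=.
  have kle : (k <= n - j)%N by rewrite -ltnS.
  have jle : (j <= n)%N by rewrite -ltnS.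
  rewrite /G !subSS subKn // iter_thetaM mulrA -iterD; congr (_ * iter _ _ _).
  by rewrite addnBA // subnKC.
transitivity (\sum_(k < n.+1) \sum_(j < n.+1 | (j <= n - k)%N) G j k).
  rewrite (exchange_big_dep predT) //=; apply: eq_bigr => k _.
  apply: eq_bigl => j.
  have kle : (k <= n)%N by rewrite -ltnS.
  have jle : (j <= n)%N by rewrite -ltnS.
  by rewrite !leq_subRL // addnC.
rewrite skew_coef_mul [RHS](reindex_inj rev_ord_inj) /=; apply: eq_bigr => k _.
have kle : (k <= n)%N by rewrite -ltnS.
rewrite subSS subKn // skew_coef_mul big_distrl /=.
rewrite (big_ord_narrow_leq (leq_subr _ _)); apply: eq_bigr => j _ /=.
by rewrite /G -!subnDA [(k + j)%N]addnC.
Qed.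

Fact skew_mul1l : left_id skew_one skew_mul.
Proof.
move=> p; apply: skew_eqP => n; rewrite skew_coef_mul big_ord_recl /= subn0.
rewrite big1 => [|i _]; rewrite /skew_coef coef1 ?mul1r ?addr0 //=.
by rewrite mul0r.
Qed.

Fact skew_mul1r : right_id skew_one skew_mul.
Proof.
move=> p; apply: skew_eqP => n; rewrite skew_coef_mul big_ord_recr /= subnn.
rewrite big1 => [|i _]; first by rewrite /skew_coef coef1 iter_theta1 mulr1 add0r.
rewrite /skew_coef coef1 subn_eq0 leqNgt ltn_ord /=.
by rewrite iter_theta0 mulr0.
Qed.

Fact skew_mulDl : left_distributive skew_mul +%R.
Proof.
move=> p q r; apply: skew_eqP => n.
rewrite skew_coefD !skew_coef_mul -big_split /=.
by apply: eq_bigr => i _; rewrite skew_coefD mulrDl.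
Qed.

Fact skew_mulDr : right_distributive skew_mul +%R.
Proof.
move=> p q r; apply: skew_eqP => n.
rewrite skew_coefD !skew_coef_mul -big_split /=.
by apply: eq_bigr => i _; rewrite skew_coefD iter_thetaD mulrDr.
Qed.

Fact skew_one_neq0 : skew_one != 0 :> sp.
Proof. exact: (oner_neq0 {poly R}). Qed.

HB.instance Definition _ := GRing.Zmodule_isNzRing.Build sp
  skew_mulA skew_mul1l skew_mul1r skew_mulDl skew_mulDr skew_one_neq0.

Definition skewC (c : R) : sp := c%:P.
Definition skewX : sp := 'X.

End SkewPoly.

(* Smooth projective geometrically connected curves over a finite field k are  *)
(* represented by their function fields: fields K/k of transcendence degree 1, *)
(* finite over k(x) for some x, in which k is algebraically closed.  Closed    *)
(* points are the valuation rings of K/k.                                      *)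
Section FunctionField.
Context {k K : fieldType} (i : {rmorphism k -> K}).

Definition is_function_field : Prop :=
  exists2 x : K, ~ algebraicOver i x &
    exists (n : nat) (e : 'I_n -> K), forall f : K,
      exists (s : {poly k}) (p : 'I_n -> {poly k}),
        s != 0 /\
        (map_poly i s).[x] * f = \sum_(j < n) (map_poly i (p j)).[x] * e j.

Definition is_full_constant_field : Prop :=
  forall f : K, algebraicOver i f -> exists c : k, f = i c.

Definition is_valuation_ring (O : set K) : Prop :=
  [/\ forall c : k, O (i c),
      forall f g, O f -> O g -> O (f - g) /\ O (f * g),
      exists f, ~ O f
    & forall f, O f \/ O f^-1].

(* The value [v 0] is irrelevant. *)
Definition is_discrete_valuation (v : K -> int) : Prop :=
  [/\ forall f g, f != 0 -> g != 0 -> v (f * g) = v f + v g,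
      forall f g, f != 0 -> g != 0 -> f + g != 0 ->
        Order.min (v f) (v g) <= v (f + g)
    & exists2 f, f != 0 & v f = 1].

Definition ring_of_valuation (v : K -> int) : set K :=
  [set f | f != 0 -> 0 <= v f].

Definition has_residue_degree1 (v : K -> int) : Prop :=
  forall f, ring_of_valuation v f ->
    exists c : k, f - i c != 0 -> 0 < v (f - i c).

End FunctionField.

Record pointed_curve : Type := PointedCurve {
  Fq : finFieldType;
  Kf : fieldType;
  Fq_to_K : {rmorphism Fq -> Kf};
  Kf_function_field : is_function_field Fq_to_K;
  Kf_constants : is_full_constant_field Fq_to_K;
  ord_infty : Kf -> int;
  ord_infty_valuation : is_discrete_valuation ord_infty;
  ord_infty_rational : has_residue_degree1 Fq_to_K ord_infty
}.

Arguments ord_infty : clear implicits.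

Definition regular_away (X : pointed_curve) : {pred Kf X} := fun f =>
  `[< forall O : set (Kf X), is_valuation_ring (Fq_to_K X) O ->
        O <> ring_of_valuation (ord_infty X) -> O f >].

Arguments regular_away : clear implicits.

Fact regular_away_subring X : subring_closed (regular_away X).
Proof.
split=> [|f g /asboolP hf /asboolP hg|f g /asboolP hf /asboolP hg].
- by apply/asboolP => O [hO _ _ _] _; rewrite -(rmorph1 (Fq_to_K X)).
- apply/asboolP => O hO nO; have [_ h _ _] := hO.
  by have [] := h _ _ (hf _ hO nO) (hg _ hO nO).
- apply/asboolP => O hO nO; have [_ h _ _] := hO.
  by have [] := h _ _ (hf _ hO nO) (hg _ hO nO).
Qed.

HB.instance Definition _ X :=
  GRing.isSubringClosed.Build (Kf X) (regular_away X) (regular_away_subring X).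

Record Aring (X : pointed_curve) : Type :=
  MkA { A_val : Kf X; A_valP : A_val \in regular_away X }.

HB.instance Definition _ X := [isSub for @A_val X].
HB.instance Definition _ X := [Choice of Aring X by <:].
HB.instance Definition _ X := [SubChoice_isSubComNzRing of Aring X by <:].

Fact iota_regular X (c : Fq X) : Fq_to_K X c \in regular_away X.
Proof. by apply/asboolP => O [hO _ _ _] _. Qed.

Definition iotaA X (c : Fq X) : Aring X := MkA (iota_regular c).

Section AbsoluteValue.
Context {RR : realType}.

Definition is_abs (F : fieldType) (a : F -> RR) : Prop :=
  [/\ forall x, 0 <= a x, forall x, (a x == 0) = (x == 0),
      forall x y, a (x * y) = a x * a y
    & forall x y, a (x + y) <= Order.max (a x) (a y)].

Definition abs_cvg (F : fieldType) (a : F -> RR) (u : nat -> F) (l : F) : Prop :=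
  forall e, 0 < e -> exists n0 : nat, forall n, (n0 <= n)%N -> a (u n - l) < e.

Definition abs_cauchy (F : fieldType) (a : F -> RR) (u : nat -> F) : Prop :=
  forall e, 0 < e -> exists n0 : nat,
    forall m n, (n0 <= m)%N -> (n0 <= n)%N -> a (u m - u n) < e.

Definition abs_complete (F : fieldType) (a : F -> RR) : Prop :=
  forall u, abs_cauchy a u -> exists l, abs_cvg a u l.

Definition is_completion (E F : fieldType) (aE : E -> RR) (aF : F -> RR)
    (i : {rmorphism E -> F}) : Prop :=
  [/\ is_abs aF, abs_complete aF, forall x, aF (i x) = aE x
    & forall (y : F) e, 0 < e -> exists x, aF (i x - y) < e].

End AbsoluteValue.

Definition is_alg_closure (E F : fieldType) (i : {rmorphism E -> F}) : Prop :=
  GRing.closed_field_axiom F /\ forall x : F, algebraicOver i x.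

(* The absolute value at infinity: |f| = q ^ (- ord_infty f). *)
Definition abs_infty (X : pointed_curve) (RR : realType) (f : Kf X) : RR :=
  if f == 0 then 0 else (#|Fq X|%:R : RR) ^ (- ord_infty X f).

Record coef_field (X : pointed_curve) : Type := CoefField {
  RR : realType;
  Kinf : fieldType;
  abs_Kinf : Kinf -> RR;
  K_to_Kinf : {rmorphism Kf X -> Kinf};
  Kinf_completion : is_completion (@abs_infty X RR) abs_Kinf K_to_Kinf;
  Kbar : fieldType;
  abs_Kbar : Kbar -> RR;
  Kinf_to_Kbar : {rmorphism Kinf -> Kbar};
  Kbar_closure : is_alg_closure Kinf_to_Kbar;
  Kbar_abs : is_abs abs_Kbar;
  Kbar_abs_ext : forall x, abs_Kbar (Kinf_to_Kbar x) = abs_Kinf x;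
  Cinf : fieldType;
  abs_Cinf : Cinf -> RR;
  Kbar_to_Cinf : {rmorphism Kbar -> Cinf};
  Cinf_completion : is_completion abs_Kbar abs_Cinf Kbar_to_Cinf;
  L : fieldType;
  L_closed : GRing.closed_field_axiom L;
  K_to_L : {rmorphism Kf X -> L};
  L_to_Cinf : {rmorphism L -> Cinf};
  K_L_Cinf : forall f,
    L_to_Cinf (K_to_L f) = Kbar_to_Cinf (Kinf_to_Kbar (K_to_Kinf f))
}.

Arguments abs_Cinf {X}.

Section Frobenius.
Context {X : pointed_curve} (E : coef_field X).
Local Notation q := #|Fq X|.
Local Notation L := (L E).

Definition iotaL (c : Fq X) : L := K_to_L E (Fq_to_K X c).

Lemma q_gt0 n : (0 < q ^ n)%N.
Proof. by rewrite expn_gt0; apply/orP; left; apply/card_gt0P; exists 0. Qed.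

Lemma pchar_q n : [pchar L].-nat (q ^ n)%N.
Proof.
have [p pr_p pF] := finPcharP (Fq X).
have pL : p \in [pchar L].
  exact: (rmorph_pchar (K_to_L E) (rmorph_pchar (Fq_to_K X) pF)).
rewrite (eq_pnat _ (pcharf_eq pL)) pnatX; apply/orP; left.
have := abelem_pgroup (fin_ring_pchar_abelem pF).
by rewrite /pgroup cardsT.
Qed.

Lemma root_q_exists n (x : L) : exists y : L, y ^+ (q ^ n) == x.
Proof.
have [y hy] := @L_closed X E (q ^ n)%N (fun i => if i == 0%N then x else 0) (q_gt0 n).
exists y; rewrite hy; case: (q ^ n)%N (q_gt0 n) => // m _.
by rewrite big_ord_recl /= expr0 mulr1 big1 ?addr0 // => i _; rewrite mul0r.
Qed.

(* x ^ (q ^ i) for i in Z *)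
Definition qpow (i : int) (x : L) : L :=
  match i with
  | Posz n => x ^+ (q ^ n)
  | Negz n => xchoose (root_q_exists n.+1 x)
  end.

Lemma powqD n : {morph (fun x : L => x ^+ (q ^ n)) : x y / x + y}.
Proof. by move=> x y; exact: (exprDn_pchar _ _ (pchar_q n)). Qed.

Lemma powqB n : {morph (fun x : L => x ^+ (q ^ n)) : x y / x - y}.
Proof.
move=> x y; apply: (addIr (y ^+ (q ^ n))).
by rewrite addrNK -powqD addrNK.
Qed.

Lemma powq_inj n : injective (fun x : L => x ^+ (q ^ n)).
Proof.
move=> x y /= h; apply/eqP; rewrite -subr_eq0.
have: (x - y) ^+ (q ^ n) == 0 by rewrite powqB h subrr.
by rewrite expf_eq0 => /andP[].
Qed.

Lemma qpow_negK n x : qpow (Negz n) x ^+ (q ^ n.+1) = x.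
Proof. exact/eqP/(xchooseP (root_q_exists n.+1 x)). Qed.

Fact qpow_zmod_morphism i : zmod_morphism (qpow i).
Proof.
case: i => n x y; first exact: powqB.
by apply: (@powq_inj n.+1); rewrite powqB !qpow_negK.
Qed.

Fact qpow_monoid_morphism i : monoid_morphism (qpow i).
Proof.
case: i => n; split=> [|x y]; rewrite /= ?expr1n ?exprMn //.
- by apply: (@powq_inj n.+1); rewrite [LHS]qpow_negK expr1n.
- by apply: (@powq_inj n.+1); rewrite exprMn !qpow_negK.
Qed.

HB.instance Definition _ i :=
  GRing.isZmodMorphism.Build L L (qpow i) (qpow_zmod_morphism i).
HB.instance Definition _ i :=
  GRing.isMonoidMorphism.Build L L (qpow i) (qpow_monoid_morphism i).

Lemma qpow_iotaL i c : qpow i (iotaL c) = iotaL c.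
Proof.
have h n : iotaL c ^+ (q ^ n) = iotaL c.
  rewrite /iotaL -!rmorphXn /=; congr (K_to_L E (Fq_to_K X _)).
  by elim: n => [|n IH]; rewrite ?expn0 ?expr1 // expnS exprM expf_card.
by case: i => n; first exact: h; apply: (@powq_inj n.+1); rewrite qpow_negK h.
Qed.

Lemma qpow_char (i : int) (m n : nat) x :
  i = n%:Z - m%:Z -> qpow i x ^+ (q ^ m) = x ^+ (q ^ n).
Proof.
case: i => k.
- move=> h; have -> : n = (k + m)%N by apply/eqP; rewrite -eqz_nat PoszD h addrNK.
  by rewrite /= -exprM -expnD.
- rewrite NegzE => h.
  have -> : m = (k.+1 + n)%N.
    apply/eqP; rewrite -eqz_nat PoszD -[k.+1%:Z]opprK h opprB addrNK //.
  by rewrite expnD exprM qpow_negK.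
Qed.

Lemma qpowD (i j : int) x : qpow i (qpow j x) = qpow (i + j) x.
Proof.
have intP (a : int) : exists m n : nat, a = n%:Z - m%:Z.
  case: a => k; first by exists 0%N, k; rewrite subr0.
  by exists k.+1, 0%N; rewrite NegzE sub0r.
have [m1 [n1 h1]] := intP i; have [m2 [n2 h2]] := intP j.
apply: (@powq_inj (m1 + m2)).
have h : i + j = (n1 + n2)%:Z - (m1 + m2)%:Z.
  by rewrite h1 h2 !PoszD opprD addrACA.
rewrite (qpow_char _ h) expnD exprM (qpow_char _ h1) exprAC (qpow_char _ h2).
by rewrite -exprM mulnC -expnD.
Qed.

Lemma qpow0 x : qpow 0 x = x. Proof. by rewrite /= expn0 expr1. Qed.

Lemma iter_qpow n (i : int) x : iter n (qpow i) x = qpow (i *+ n) x.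
Proof.
by elim: n => [|n IH] /=; rewrite ?qpow0 // IH qpowD mulrS.
Qed.

End Frobenius.

Section LA.
Context {X : pointed_curve} (E : coef_field X).
Local Notation L := (L E).
Local Notation A := (Aring X).

Definition LA : Type :=
  tensor (fun c (l : L) => iotaL E c * l) (fun c (a : A) => iotaA c * a).
HB.instance Definition _ := GRing.Zmodule.on LA.

Definition tens (l : L) (a : A) : LA := tensor_pure _ _ l a.

Definition LA_balanced {W : zmodType} (b : L -> A -> W) :=
  balanced (fun c (l : L) => iotaL E c * l) (fun c (a : A) => iotaA c * a) b.

Lemma tens_balanced : LA_balanced tens.
Proof. exact: tensor_pure_balanced. Qed.

Definition LA_lift {W : zmodType} (b : L -> A -> W) (t : LA) : W :=
  tensor_lift b t.

Lemma LA_liftD {W : zmodType} (b : L -> A -> W) : LA_balanced b ->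
  {morph LA_lift b : x y / x + y}.
Proof. by move=> hb x y; exact: (tensor_liftD hb). Qed.

Lemma LA_lift_tens {W : zmodType} (b : L -> A -> W) l a : LA_balanced b ->
  LA_lift b (tens l a) = b l a.
Proof. by move=> hb; exact: (tensor_lift_pure hb). Qed.

Lemma LA_ext (W : zmodType) (f g : LA -> W) :
  {morph f : x y / x + y} -> {morph g : x y / x + y} ->
  (forall l a, f (tens l a) = g (tens l a)) -> f =1 g.
Proof. exact: tensor_ext. Qed.

Definition LA_mul (x y : LA) : LA :=
  LA_lift (fun l a => LA_lift (fun l' a' => tens (l * l') (a * a')) y) x.
Definition LA_one : LA := tens 1 1.

Lemma LA_mul_balanced2 l a : LA_balanced (fun l' a' => tens (l * l') (a * a')).
Proof.
have [h1 h2 h3] := tens_balanced.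
split=> [a' x y|l' x y|c l' a']; rewrite ?mulrDr ?h1 ?h2 //.
by rewrite mulrCA h3 mulrCA.
Qed.

Lemma LA_mul_balanced1 y :
  LA_balanced (fun l a => LA_lift (fun l' a' => tens (l * l') (a * a')) y).
Proof.
have [h1 h2 h3] := tens_balanced.
split=> [a l1 l2|l a1 a2|c l a]; move: y.
- apply: LA_ext => [|x y|l a'].
  + exact: LA_liftD (LA_mul_balanced2 _ _).
  + by rewrite !(LA_liftD (LA_mul_balanced2 _ _)) addrACA.
  + by rewrite !(LA_lift_tens _ _ (LA_mul_balanced2 _ _)) mulrDl h1.
- apply: LA_ext => [|x y|l' a'].
  + exact: LA_liftD (LA_mul_balanced2 _ _).
  + by rewrite !(LA_liftD (LA_mul_balanced2 _ _)) addrACA.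
  + by rewrite !(LA_lift_tens _ _ (LA_mul_balanced2 _ _)) mulrDl h2.
- apply: LA_ext => [||l' a'].
  + exact: LA_liftD (LA_mul_balanced2 _ _).
  + exact: LA_liftD (LA_mul_balanced2 _ _).
  + by rewrite !(LA_lift_tens _ _ (LA_mul_balanced2 _ _)) -!mulrA h3.
Qed.

Lemma LA_mulDl : left_distributive LA_mul +%R.
Proof. by move=> x y z; exact: (LA_liftD (LA_mul_balanced1 z)). Qed.

Lemma LA_mul_tens l a l' a' : LA_mul (tens l a) (tens l' a') = tens (l * l') (a * a').
Proof.
by rewrite /LA_mul (LA_lift_tens _ _ (LA_mul_balanced1 _))
   (LA_lift_tens _ _ (LA_mul_balanced2 _ _)).
Qed.

Lemma LA_mulDr : right_distributive LA_mul +%R.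
Proof.
move=> x y z; move: x; apply: LA_ext => [x x'|x x'|l a].
- by rewrite LA_mulDl.
- by rewrite !LA_mulDl addrACA.
rewrite /LA_mul !(LA_lift_tens _ _ (LA_mul_balanced1 _)).
exact: LA_liftD (LA_mul_balanced2 _ _) _ _.
Qed.

Fact LA_mulC : commutative LA_mul.
Proof.
move=> x y; move: x; apply: LA_ext => [x x'|x x'|l a]; rewrite ?LA_mulDl ?LA_mulDr //.
move: y; apply: LA_ext => [x x'|x x'|l' a']; rewrite ?LA_mulDl ?LA_mulDr //.
by rewrite !LA_mul_tens mulrC [a * _]mulrC.
Qed.

Fact LA_mulA : associative LA_mul.
Proof.
move=> x y z; move: x; apply: LA_ext => [x x'|x x'|l a]; rewrite ?LA_mulDl //.
move: y; apply: LA_ext => [x x'|x x'|l' a']; rewrite ?LA_mulDl ?LA_mulDr ?LA_mulDl //.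
move: z; apply: LA_ext => [x x'|x x'|l'' a'']; rewrite ?LA_mulDr //.
by rewrite !LA_mul_tens !mulrA.
Qed.

Fact LA_mul1 : left_id LA_one LA_mul.
Proof.
apply: LA_ext => [x x'|//|l a]; first by rewrite LA_mulDr.
by rewrite LA_mul_tens !mul1r.
Qed.

Fact LA_one_neq0 : LA_one != 0.
Proof.
pose b (l : L) (a : A) : L := l * K_to_L E (A_val a).
have hb : LA_balanced b.
  split=> [a x y|l x y|c l a]; rewrite /b ?mulrDl //.
  - by rewrite -mulrDr -rmorphD.
  - rewrite (_ : A_val (iotaA c * a) = Fq_to_K X c * A_val a) //.
    by rewrite rmorphM mulrCA mulrA.
have b0 : LA_lift b 0 = 0.
  by apply: (addrI (LA_lift b 0)); rewrite -(LA_liftD hb) !addr0.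
apply/eqP => h; have := LA_lift_tens 1 1 hb.
rewrite -[tens 1 1]/LA_one h b0 /b mul1r.
rewrite (_ : A_val (1 : A) = 1) // rmorph1 => /esym/eqP.
by rewrite oner_eq0.
Qed.

HB.instance Definition _ := GRing.Zmodule_isComNzRing.Build LA
  LA_mulA LA_mulC LA_mul1 LA_mulDl LA_one_neq0.

Lemma tensM l a l' a' : tens l a * tens l' a' = tens (l * l') (a * a').
Proof. exact: LA_mul_tens. Qed.

(* h |-> h^(i) on L (x) A *)
Definition twist (i : int) : LA -> LA := LA_lift (fun l a => tens (qpow i l) a).

Lemma twist_balanced i : LA_balanced (fun l a => tens (qpow i l) a).
Proof.
have [h1 h2 h3] := tens_balanced.
split=> [a x y|l x y|c l a]; rewrite ?rmorphD ?h1 ?h2 //.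
by rewrite rmorphM /= qpow_iotaL h3.
Qed.

Lemma twistD i : {morph twist i : x y / x + y}.
Proof. exact: LA_liftD (twist_balanced i). Qed.

Lemma twist_tens i l a : twist i (tens l a) = tens (qpow i l) a.
Proof. by rewrite /twist (LA_lift_tens _ _ (twist_balanced i)). Qed.

Fact twist_zmod_morphism i : zmod_morphism (twist i).
Proof.
move=> x y; apply: (addIr (twist i y)).
by rewrite addrNK -twistD addrNK.
Qed.

Fact twist_monoid_morphism i : monoid_morphism (twist i).
Proof.
split=> [|x y]; first by rewrite [LHS]twist_tens rmorph1.
move: x; apply: LA_ext => [x x'|x x'|l a]; rewrite ?mulrDl ?twistD ?mulrDl //.
move: y; apply: LA_ext => [x x'|x x'|l' a'];
  rewrite ?mulrDr ?twistD ?mulrDr //.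
by rewrite tensM !twist_tens tensM rmorphM.
Qed.

HB.instance Definition _ i :=
  GRing.isZmodMorphism.Build LA LA (twist i) (twist_zmod_morphism i).
HB.instance Definition _ i :=
  GRing.isMonoidMorphism.Build LA LA (twist i) (twist_monoid_morphism i).

(* Commuting actions of L and A on an abelian group that agree on F_q make it *)
(* an (L (x) A)-module.                                                       *)
Section Action.
Context {W : zmodType} (aL : L -> W -> W) (aA : A -> W -> W).

Record commuting_actions : Prop := CommutingActions {
  actL_D : forall l, {morph aL l : x y / x + y};
  actL_Dl : forall w, {morph aL^~ w : x y / x + y};
  actL_M : forall l l' w, aL (l * l') w = aL l (aL l' w);
  actL_1 : forall w, aL 1 w = w;
  actA_D : forall a, {morph aA a : x y / x + y};
  actA_Dl : forall w, {morph aA^~ w : x y / x + y};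
  actA_M : forall a a' w, aA (a * a') w = aA a (aA a' w);
  actA_1 : forall w, aA 1 w = w;
  act_comm : forall l a w, aL l (aA a w) = aA a (aL l w);
  act_Fq : forall c w, aL (iotaL E c) w = aA (iotaA c) w
}.

Definition LA_scale (t : LA) (w : W) : W := LA_lift (fun l a => aL l (aA a w)) t.

Context (h : commuting_actions).

Lemma LA_scale_balanced w : LA_balanced (fun l a => aL l (aA a w)).
Proof.
split=> [a x y|l x y|c l a].
- exact: actL_Dl.
- by rewrite actA_Dl // actL_D.
- by rewrite mulrC actL_M // act_Fq // -actA_M.
Qed.

Lemma LA_scale_tens l a w : LA_scale (tens l a) w = aL l (aA a w).
Proof. exact: LA_lift_tens (LA_scale_balanced w). Qed.

Lemma LA_scaleDl w : {morph LA_scale^~ w : s t / s + t}.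
Proof. exact: LA_liftD (LA_scale_balanced w). Qed.

Lemma LA_scaleDr : right_distributive LA_scale +%R.
Proof.
move=> t v w; move: t; apply: LA_ext => [s t|s t|l a].
- exact: LA_scaleDl.
- by rewrite !LA_scaleDl addrACA.
- by rewrite !LA_scale_tens actA_D // actL_D.
Qed.

Lemma LA_scaleA s t w : LA_scale s (LA_scale t w) = LA_scale (s * t) w.
Proof.
move: s; apply: LA_ext => [x y|x y|l a]; rewrite ?mulrDl ?LA_scaleDl //.
move: t; apply: LA_ext => [x y|x y|l' a'];
  rewrite ?mulrDr ?LA_scaleDl ?LA_scaleDr //.
by rewrite tensM !LA_scale_tens actL_M // actA_M // (act_comm h l' a).
Qed.

Lemma LA_scale1 : left_id 1 LA_scale.
Proof. by move=> w; rewrite [LHS]LA_scale_tens actL_1 // actA_1. Qed.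

End Action.
End LA.

Arguments tens {X} E l a.

Section Ideals.
Context {R : comNzRingType}.

Definition add_span (V : zmodType) (S : set V) : set V :=
  [set x | exists2 s : seq V, (forall y, y \in s -> S y) & x = \sum_(y <- s) y].

Definition ideal_gen (G : set R) : set R :=
  add_span [set x | exists r g, G g /\ x = r * g].

Fixpoint ideal_pow (I : set R) (n : nat) : set R :=
  if n is n'.+1 then
    add_span [set x | exists r s, [/\ I r, ideal_pow I n' s & x = r * s]]
  else setT.

Definition ideal_mul (U : lmodType R) (I : set R) (V : set U) : set U :=
  add_span [set x | exists r u, [/\ I r, V u & x = r *: u]].

Definition is_fin_gen (U : lmodType R) : Prop :=
  exists (n : nat) (e : 'I_n -> U), forall u, exists c : 'I_n -> R,
    u = \sum_(i < n) c i *: e i.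

Definition is_projective (U : lmodType R) : Prop :=
  forall (V W : lmodType R) (g : {linear V -> W}) (f : {linear U -> W}),
    (forall w, exists v, g v = w) ->
    exists h : {linear U -> V}, forall u, g (h u) = f u.

End Ideals.

Record frac_field (R : comNzRingType) : Type := FracField {
  frac_sort :> fieldType;
  frac_map : {rmorphism R -> frac_sort};
  frac_map_inj : injective frac_map;
  frac_mapP : forall f, exists r s, s != 0 /\ f = frac_map r / frac_map s
}.

(* Localizations are taken inside Q and inside U (x)_R Q: for a multiplicative *)
(* set S without 0 and U torsion-free (e.g. projective), S^-1 R and S^-1 U     *)
(* embed there.                                                                *)
Section Localization.
Context {R : comNzRingType} (Q : frac_field R).

Definition loc_ring (S : set R) : set Q :=
  [set f | exists r s, S s /\ f = frac_map Q r / frac_map Q s].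

Definition frac_ext (theta : R -> R) (f : Q) : Q :=
  let p := xget (0, 1) [set p : R * R | p.2 != 0 /\
                          f = frac_map Q p.1 / frac_map Q p.2] in
  frac_map Q (theta p.1) / frac_map Q (theta p.2).

Section Module.
Context (U : lmodType R).

Definition extQ : Type :=
  tensor (fun (r : R) (u : U) => r *: u) (fun (r : R) (f : Q) => frac_map Q r * f).
HB.instance Definition _ := GRing.Zmodule.on extQ.

Definition extQ_pure (u : U) (f : Q) : extQ := tensor_pure _ _ u f.

Definition extQ_scale (f : Q) : extQ -> extQ :=
  tensor_lift (fun u g => extQ_pure u (f * g)).

Lemma extQ_scale_balanced f : balanced (fun (r : R) (u : U) => r *: u)
  (fun (r : R) (g : Q) => frac_map Q r * g) (fun u g => extQ_pure u (f * g)).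
Proof.
have [h1 h2 h3] := tensor_pure_balanced (fun (r : R) (u : U) => r *: u)
  (fun (r : R) (g : Q) => frac_map Q r * g).
split=> [g x y|u x y|r u g]; first exact: h1.
- by rewrite mulrDr; exact: h2.
- by rewrite mulrCA; exact: h3.
Qed.

Lemma extQ_scale_pure f u g : extQ_scale f (extQ_pure u g) = extQ_pure u (f * g).
Proof. exact: tensor_lift_pure (extQ_scale_balanced f) _ _. Qed.

Fact extQ_scaleDr : right_distributive extQ_scale +%R.
Proof. by move=> f x y; exact: (tensor_liftD (extQ_scale_balanced f)). Qed.

Fact extQ_scaleDl x : {morph extQ_scale^~ x : f g / f + g}.
Proof.
move=> f g; move: x; apply: tensor_ext => [x y|x y|u h]; first exact: extQ_scaleDr.
- by rewrite !extQ_scaleDr addrACA.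
- rewrite !extQ_scale_pure mulrDl.
  by have [_ h2 _] := tensor_pure_balanced (fun (r : R) (u : U) => r *: u)
       (fun (r : R) (g : Q) => frac_map Q r * g); exact: h2.
Qed.

Fact extQ_scaleA f g x : extQ_scale f (extQ_scale g x) = extQ_scale (f * g) x.
Proof.
move: x; apply: tensor_ext => [x y|x y|u h]; rewrite ?extQ_scaleDr //.
by rewrite !extQ_scale_pure mulrA.
Qed.

Fact extQ_scale1 : left_id 1 extQ_scale.
Proof.
apply: tensor_ext => [x y|//|u h]; first by rewrite extQ_scaleDr.
by rewrite extQ_scale_pure mul1r.
Qed.

HB.instance Definition _ := GRing.Zmodule_isLmodule.Build Q extQ
  extQ_scaleA extQ_scale1 extQ_scaleDr extQ_scaleDl.

Definition loc_module (S : set R) : set extQ :=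
  [set x | exists u s, S s /\ x = extQ_pure u (frac_map Q s)^-1].

Definition is_basis (B : set Q) (V : set extQ) (n : nat) (c : 'I_n -> extQ) : Prop :=
  (forall i, V (c i)) /\
  (forall x, V x -> exists! f : 'rV[Q]_n,
     (forall i, B (f 0 i)) /\ x = \sum_(i < n) f 0 i *: c i).

Definition has_constant_rank (n : nat) : Prop :=
  forall p : {pred R}, idealr_closed p -> prime_idealr_closed p ->
    exists c : 'I_n -> extQ,
      is_basis (loc_ring [set s | s \notin p]) (loc_module [set s | s \notin p]) c.

End Module.
End Localization.

Section Xi.
Context {X : pointed_curve} (E : coef_field X).

Definition Jideal (i : int) : set (LA E) :=
  ideal_gen [set g | exists a : Aring X,
    g = tens E 1 a - tens E (qpow i (K_to_L E (A_val a))) 1].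

Definition regular_at_Xi (Q : frac_field (LA E)) (i : int) : set Q :=
  loc_ring (~` Jideal i).

Definition nonzero_A : set (LA E) :=
  [set s | exists2 a : Aring X, a != 0 & s = tens E 1 a].

(* As K is the fraction field of A, L (x) K and M (x)_A K are the localizations *)
(* of L (x) A and M at the nonzero elements of A.                               *)
Definition LK (Q : frac_field (LA E)) : set Q := loc_ring nonzero_A.

End Xi.

Arguments Jideal {X} E i _ : rename.
Arguments nonzero_A {X} E _ : rename.
Arguments regular_at_Xi {X E} Q i _ : rename.
Arguments LK {X E} Q _ : rename.

Notation Ltau E := (skewpoly (@qpow _ E 1)).
Notation Lsigma E := (skewpoly (@qpow _ E (-1))).
Notation LAtau E := (skewpoly (@twist _ E 1)).
Notation LAsigma E := (skewpoly (@twist _ E (-1))).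

Section Anderson.
Context {X : pointed_curve} (E : coef_field X).
Local Notation L := (L E).
Local Notation A := (Aring X).
Local Notation C := (Cinf E).
Local Notation q := #|Fq X|.

Local Notation Ltau := (Ltau E).
Local Notation Lsigma := (Lsigma E).

(* Mat_d(L)[tau] is realized as Mat_d(L[tau]); [mx_coef b i] is the matrix *)
(* coefficient of tau^i.                                                   *)
Definition mx_coef d (b : 'M[Ltau]_d) (i : nat) : 'M[L]_d :=
  \matrix_(k, l) skew_coef (b k l) i.

Definition star1 (p : Ltau) : Lsigma :=
  \poly_(i < size (p : {poly L})) qpow (- (i%:Z)) (skew_coef p i).

Definition star d (b : 'M[Ltau]_d) : 'M[Lsigma]_d :=
  \matrix_(k, l) star1 (b l k).

Record anderson_module (d : nat) : Type := AndersonModule {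
  am_map :> {rmorphism A -> 'M[Ltau]_d};
  am_Fq : forall c, am_map (iotaA c) = (skewC _ (iotaL E c))%:M;
  am_tangent : forall a, exists2 N : 'M[L]_d, exists n, N ^+ n = 0 &
    mx_coef (am_map a) 0 = (K_to_L E (A_val a))%:M + N
}.

Definition motive d (phi : anderson_module d) : Type := 'rV[Ltau]_d.
Definition dual_motive d (phi : anderson_module d) : Type := 'rV[Lsigma]_d.

Section Motives.
Context {d : nat} (phi : anderson_module d).
HB.instance Definition _ := GRing.Zmodule.on (motive phi).
HB.instance Definition _ := GRing.Zmodule.on (dual_motive phi).

Lemma skewC_D (theta : {rmorphism L -> L}) : {morph skewC theta : x y / x + y}.
Proof. by move=> x y; exact: polyCD. Qed.

Lemma skew_coefC (theta : {rmorphism L -> L}) c n :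
  skew_coef (skewC theta c) n = if n == 0%N then c else 0.
Proof. exact: coefC. Qed.

Lemma skew_coefCM (theta : {rmorphism L -> L}) c (p : skewpoly theta) n :
  skew_coef (skewC theta c * p) n = c * skew_coef p n.
Proof.
rewrite [LHS]skew_coef_mul big_ord_recl /= subn0 skew_coefC /=.
by rewrite big1 ?addr0 // => i _; rewrite skew_coefC /= mul0r.
Qed.

Lemma skewC_M (theta : {rmorphism L -> L}) x y :
  skewC theta (x * y) = skewC theta x * skewC theta y.
Proof.
apply: skew_eqP => n; rewrite skew_coefCM !skew_coefC.
by case: eqP; rewrite ?mulr0.
Qed.

Lemma skewC_comm (theta : {rmorphism L -> L}) c (p : skewpoly theta) :
  theta c = c -> skewC theta c * p = p * skewC theta c.
Proof.
move=> hc; apply: skew_eqP => n; rewrite skew_coefCM [RHS]skew_coef_mul.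
have h i : iter i theta c = c by elim: i => //= i ->.
rewrite big_ord_recr /= subnn skew_coefC /= h big1 ?add0r 1?mulrC // => i _.
by rewrite skew_coefC subn_eq0 leqNgt ltn_ord /= iter_theta0 mulr0.
Qed.

Definition motive_actL (l : L) (m : motive phi) : motive phi :=
  skewC _ l *: (m : 'rV[Ltau]_d).
Definition motive_actA (a : A) (m : motive phi) : motive phi :=
  (m : 'rV[Ltau]_d) *m phi a.

Lemma motive_actions : commuting_actions motive_actL motive_actA.
Proof.
split; rewrite /motive_actL /motive_actA.
- by move=> l x y; rewrite scalerDr.
- by move=> w x y; rewrite skewC_D scalerDl.
- by move=> l l' w; rewrite skewC_M scalerA.
- by move=> w; rewrite (_ : skewC _ 1 = 1) // scale1r.
- by move=> a x y; rewrite mulmxDl.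
- by move=> w x y; rewrite rmorphD mulmxDr.
- by move=> a a' w; rewrite mulrC rmorphM mulmxA.
- by move=> w; rewrite rmorph1 mulmx1.
- by move=> l a w; rewrite scalemxAl.
- move=> c w; rewrite am_Fq; apply/rowP => k; rewrite !mxE (bigD1 k) //= mxE eqxx.
  rewrite mulr1n big1 ?addr0 => [|j /negPf jk]; last by rewrite mxE jk mulr0n mulr0.
  by apply: skewC_comm; exact: qpow_iotaL.
Qed.

HB.instance Definition _ := GRing.Zmodule_isLmodule.Build (LA E) (motive phi)
  (LA_scaleA motive_actions) (LA_scale1 motive_actions)
  (LA_scaleDr motive_actions) (LA_scaleDl motive_actions).

Lemma skew_coef_star1 p n :
  skew_coef (star1 p) n = qpow (- (n%:Z)) (skew_coef p n).
Proof.
rewrite {1}/skew_coef coef_poly; case: ltnP => // h.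
by rewrite /skew_coef nth_default // rmorph0.
Qed.

Lemma star1D : {morph star1 : p r / p + r}.
Proof.
move=> p r; apply: skew_eqP => n.
by rewrite skew_coef_star1 !skew_coefD !skew_coef_star1 rmorphD.
Qed.

Lemma star1_0 : star1 0 = 0.
Proof. by apply: (addrI (star1 0)); rewrite -star1D !addr0. Qed.

Lemma star1C c : star1 (skewC _ c) = skewC _ c.
Proof.
apply: skew_eqP => n; rewrite skew_coef_star1 !skew_coefC.
by case: eqP => [->|_]; rewrite ?oppr0 ?qpow0 ?rmorph0.
Qed.

Lemma star1M p r : star1 (p * r) = star1 r * star1 p.
Proof.
apply: skew_eqP => n; rewrite skew_coef_star1 [X in qpow _ X]skew_coef_mul.
rewrite [RHS]skew_coef_mul (reindex_inj rev_ord_inj) rmorph_sum /=.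
apply: eq_bigr => j _; have hj : (j <= n)%N by rewrite -ltnS.
rewrite subSS subKn // rmorphM /= !skew_coef_star1 !iter_qpow !qpowD mulrC.
congr (qpow _ _ * qpow _ _).
  by rewrite natz -subzn // addrA addNr sub0r.
by rewrite mulNrn natz -subzn // opprB addrA addNr sub0r.
Qed.

Definition dual_actL (l : L) (n : dual_motive phi) : dual_motive phi :=
  skewC _ l *: (n : 'rV[Lsigma]_d).
Definition dual_actA (a : A) (n : dual_motive phi) : dual_motive phi :=
  (n : 'rV[Lsigma]_d) *m star (phi a).

Lemma starD : {morph @star d : b c / b + c}.
Proof. by move=> b c; apply/matrixP => k l; rewrite !mxE star1D. Qed.

Lemma starM (b c : 'M[Ltau]_d) : star (b *m c) = star c *m star b.
Proof.
apply/matrixP => k l; rewrite !mxE (big_morph _ star1D star1_0).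
by apply: eq_bigr => j _; rewrite star1M !mxE.
Qed.

Lemma star_scalar c : star (skewC _ c)%:M = (skewC _ c)%:M :> 'M[Lsigma]_d.
Proof.
apply/matrixP => k l; rewrite !mxE eq_sym.
by case: eqP; rewrite ?mulr1n ?mulr0n ?star1C ?star1_0.
Qed.

Lemma dual_actions : commuting_actions dual_actL dual_actA.
Proof.
split; rewrite /dual_actL /dual_actA.
- by move=> l x y; rewrite scalerDr.
- by move=> w x y; rewrite skewC_D scalerDl.
- by move=> l l' w; rewrite skewC_M scalerA.
- by move=> w; rewrite (_ : skewC _ 1 = 1) // scale1r.
- by move=> a x y; rewrite mulmxDl.
- by move=> w x y; rewrite rmorphD starD mulmxDr.
- by move=> a a' w; rewrite rmorphM starM mulmxA.
- move=> w; rewrite rmorph1 (_ : 1 = (skewC _ 1)%:M) // star_scalar.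
  by rewrite (_ : skewC _ 1 = 1) // mulmx1.
- by move=> l a w; rewrite scalemxAl.
- move=> c w; rewrite am_Fq star_scalar; apply/rowP => k.
  rewrite !mxE (bigD1 k) //= mxE eqxx.
  rewrite mulr1n big1 ?addr0 => [|j /negPf jk]; last by rewrite mxE jk mulr0n mulr0.
  by apply: skewC_comm; exact: qpow_iotaL.
Qed.

HB.instance Definition _ := GRing.Zmodule_isLmodule.Build (LA E) (dual_motive phi)
  (LA_scaleA dual_actions) (LA_scale1 dual_actions)
  (LA_scaleDr dual_actions) (LA_scaleDl dual_actions).

Definition tauM (m : motive phi) : motive phi := skewX _ *: (m : 'rV[Ltau]_d).
Definition sigmaN (n : dual_motive phi) : dual_motive phi :=
  skewX _ *: (n : 'rV[Lsigma]_d).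

Definition LAtau_act (x : LAtau E) (m : motive phi) : motive phi :=
  \sum_(i < size (x : {poly LA E})) skew_coef x i *: iter i tauM m.
Definition LAsigma_act (y : LAsigma E) (n : dual_motive phi) : dual_motive phi :=
  \sum_(i < size (y : {poly LA E})) skew_coef y i *: iter i sigmaN n.

Definition gM (k : 'I_d) : motive phi := (delta_mx 0 k : 'rV[Ltau]_d).
Definition hN (k : 'I_d) : dual_motive phi := (delta_mx 0 k : 'rV[Lsigma]_d).

Definition delta0 (m : motive phi) : 'cV[L]_d :=
  \col_k skew_coef ((m : 'rV[Ltau]_d) 0 k) 0.

Definition is_abelian_motive (Q : frac_field (LA E)) (r : nat) : Prop :=
  [/\ is_fin_gen (motive phi), is_projective (motive phi),
      has_constant_rank Q (motive phi) r
    & exists n0 : nat, forall n, (n0 <= n)%N ->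
        ideal_mul (ideal_pow (Jideal E 0) n) [set: motive phi] `<=` range tauM].

Definition is_A_finite_dual_motive (Q : frac_field (LA E)) (r : nat) : Prop :=
  [/\ is_fin_gen (dual_motive phi), is_projective (dual_motive phi),
      has_constant_rank Q (dual_motive phi) r
    & exists n0 : nat, forall n, (n0 <= n)%N ->
        ideal_mul (ideal_pow (Jideal E 0) n) [set: dual_motive phi]
          `<=` range sigmaN].

Section Pairing.
Context (Q : frac_field (LA E)).
Local Notation MQ := (extQ Q (motive phi)).

Definition tauQ : MQ -> MQ :=
  tensor_lift (fun m f => extQ_pure (tauM m) (frac_ext (twist 1) f)).

Definition tauQ_inv (x : MQ) : MQ := xget 0 [set y | tauQ y = x].

Definition MJ : set MQ := loc_module (~` Jideal E 0).

Definition JnMJ (n : nat) : set MQ :=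
  add_span [set x | exists j y,
    [/\ ideal_pow (Jideal E 0) n j, MJ y & x = frac_map Q j *: y]].

(* The extension of [delta0] to M_J through M_J / J^n M_J = M / J^n M, where *)
(* n is such that J^n M is contained in tau M.                               *)
Definition delta0_J (x : MQ) : 'cV[L]_d :=
  delta0 (xget 0 [set m : motive phi | exists n : nat,
    ideal_mul (ideal_pow (Jideal E 0) n) [set: motive phi] `<=` range tauM
    /\ JnMJ n (x - extQ_pure m 1)]).

Definition Xi_regular (r : nat) : Prop :=
  exists (c : 'I_r -> MQ) (Phi : 'M[Q]_r),
    [/\ is_basis (LK Q) (loc_module (nonzero_A E)) c,
        forall k l, LK Q (Phi k l),
        forall k, tauQ (c k) = \sum_(l < r) Phi k l *: c l,
        forall i, regular_at_Xi Q i (\det Phi)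
      & forall i k l, regular_at_Xi Q i (Phi k l)].

(* Formal sums \sum_k \sum_j c_{k,j} sigma^j h_k are represented by the *)
(* sequences j |-> (c_{1,j}, ..., c_{d,j}).                               *)
Definition dual_coef (n : dual_motive phi) (j : nat) : 'rV[L]_d :=
  \row_k skew_coef ((n : 'rV[Lsigma]_d) 0 k) j.

(* j |-> ((c_{1,j}, ..., c_{d,j})^(j))^T in C_infty^d *)
Definition sigma_term (c : nat -> 'rV[L]_d) (j : nat) : 'cV[C]_d :=
  \col_k L_to_Cinf E (qpow j%:Z (c j 0 k)).

Definition cvg_vec (u : nat -> 'cV[C]_d) (l : 'cV[C]_d) : Prop :=
  forall k, abs_cvg (abs_Cinf E) (fun n => u n k 0) (l k 0).

(* The sum of a convergent series; 0 if it diverges. *)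
Definition vec_series (u : nat -> 'cV[C]_d) : 'cV[C]_d :=
  xget 0 [set l | cvg_vec (fun n => \sum_(j < n) u j) l].

Definition in_N_sigma (c : nat -> 'rV[L]_d) : Prop := cvg_vec (sigma_term c) 0.

Definition delta1 (c : nat -> 'rV[L]_d) : 'cV[C]_d := vec_series (sigma_term c).

Definition F_summand (x : LAtau E) (y : LAsigma E) (z : 'cV[L]_d) (i : nat) :
    dual_motive phi :=
  \sum_(k < d)
    dual_actL
      (((delta0_J (iter i tauQ_inv (extQ_pure (LAtau_act x (gM k)) 1)))^T *m z) 0 0)
      (iter i sigmaN (LAsigma_act y (hN k))).

(* The i-th summand lies in sigma^i N, so only i <= j contribute to the *)
(* coefficient of sigma^j.                                              *)
Definition F_series (x : LAtau E) (y : LAsigma E) (z : 'cV[L]_d) (j : nat) : 'rV[L]_d :=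
  \sum_(i < j.+1) dual_coef (F_summand x y z i) j.

Definition F_pairing (x : LAtau E) (y : LAsigma E) (z : 'cV[L]_d) : 'cV[C]_d :=
  delta1 (F_series x y z).

End Pairing.

(* Twisted power series \sum_i P_i tau^i over Mat_d(C_infty), i.e. F_q-linear *)
(* power series \sum_i P_i z^(i), under composition.                          *)
Definition ts_comp (P R : nat -> 'M[C]_d) (n : nat) : 'M[C]_d :=
  \sum_(i < n.+1) P i *m map_mx (fun x => x ^+ (q ^ i)) (R (n - i)%N).

Definition ts_phi (a : A) (i : nat) : 'M[C]_d :=
  map_mx (L_to_Cinf E) (mx_coef (phi a) i).

Definition ts_const (D : 'M[C]_d) (i : nat) : 'M[C]_d := if i == 0%N then D else 0.

(* Exp(d[a] z) = phi_a(Exp(z)) as an identity of twisted power series. *)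
Definition is_exp_series (P : nat -> 'M[C]_d) : Prop :=
  P 0%N = 1%:M /\
  forall (a : A) (n : nat),
    ts_comp P (ts_const (ts_phi a 0)) n = ts_comp (ts_phi a) P n.

Definition Exp (z : 'cV[C]_d) : 'cV[C]_d :=
  let P := xget (fun=> 0) [set P : nat -> 'M[C]_d | is_exp_series P] in
  vec_series (fun i => P i *m map_mx (fun x => x ^+ (q ^ i)) z).

End Motives.
End Anderson.

(* Main.v *)
Require Import Defs.
From HB Require Import structures.
From mathcomp Require Import all_boot all_order all_algebra finfield.
From mathcomp Require Import boolp classical_sets reals ring lra zify.

Set Implicit Arguments.
Unset Strict Implicit.
Unset Printing Implicit Defensive.

Import Order.TTheory GRing.Theory Num.Theory.

Local Open Scope classical_set_scope.
Local Open Scope ring_scope.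

(* With [B_n] the matrix whose k-th row is [delta_0 (tau^-n g_k)^T], the pairing   *)
(* [F(1, 1; z)] is by definition the series of the terms [B_n^(n) z^(n)].          *)
(* Expanding [a g_k = g_k phi_a] in powers of tau, applying [tau^-n] and then      *)
(* [delta_0], which kills [tau M], gives                                           *)
(*   [B_n d[a] = \sum_(i <= n) A_{a,i}^(-n) B_(n-i)],                              *)
(* whose n-th twist is the functional equation of [Exp].  An element [a] of A      *)
(* transcendental over F_q exists because M is finitely generated and not finite   *)
(* over L; [|a| > 1], since otherwise a valuation ring of K avoiding [a] would     *)
(* contradict regularity away from infinity.  A q-power of [a] acts on the tangent *)
(* space as a scalar [t], and then                                                 *)
(*   [(t^(q^n) - t) Q_n = \sum_(1 <= i) A_i Q_(n-i)^(i)]                           *)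
(* gives both the uniqueness of [Exp] and the decay of [Q_n z^(n)].                *)
(* Finally [tau^-n g_k] lies in M_J because [J^n0 M] is contained in [tau M]: its  *)
(* denominators divide products of twists [w^(-j)], [j >= 1], of                   *)
(* [w = (1 (x) a - a (x) 1)^n0], none of which vanishes at Xi.                     *)

(** * Valuation rings avoiding a transcendental element *)

(** Both sides are series with the same terms, so the theorem reduces to an identity of coefficients
    and a decay estimate. In the pairing, the coefficient of [sigma^n] comes from the n-th summand
    alone, and the resulting term is [exp_coef n] applied to [z^(n)] ([sigma_term_F]). Computing
    [delta_0] of [a . tau^-n g_k] in two ways gives [tau_inv_mx_rel], which [exp_coef_series] twists
    into the functional equation; [exp_series_unique] then identifies [exp_coef] with the series
    chosen in [Exp]. Working with [delta_0] on M_J rests on the isomorphism between M / J^n M and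
    M_J / J^n M_J ([JnMJ_pure], [MJ_approx]) and on [iter_tauQ_inv_MJ]. Uniqueness and decay
    ([recursion_entire]) both use an element of A acting on the tangent space as a scalar of
    absolute value greater than 1; it comes from [exists_transcendental], [regular_away_pole] and
    [exists_scalar_tangent]. *)

Section Chevalley.
Context {k K : fieldType} (i : {rmorphism k -> K}) (b : K).

Definition avoids (S : set K) : Prop :=
  [/\ S b^-1, forall c, S (i c), forall f g, S f -> S g -> S (f - g),
      forall f g, S f -> S g -> S (f * g) & ~ S b].

Lemma exists_avoiding : ~ algebraicOver i b -> exists S, avoids S.
Proof.
move=> tb; have b0 : b != 0.
  by apply/eqP => b0; apply: tb; rewrite b0; exact: algebraic0.
exists [set x | exists p : {poly k}, x = (map_poly i p).[b^-1]]; split.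
- by exists 'X; rewrite map_polyX hornerX.
- by move=> c; exists c%:P; rewrite map_polyC hornerC.
- by move=> f g [p ->] [p' ->]; exists (p - p'); rewrite rmorphB hornerD hornerN.
- by move=> f g [p ->] [p' ->]; exists (p * p'); rewrite rmorphM hornerM.
case=> p hp; apply: tb; rewrite -[b]invrK; apply: algebraic_inv.
exists ('X * p - 1).
  apply/eqP => /(congr1 (fun r : {poly k} => r`_0)).
  by rewrite coefB coefXM coef1 coef0 sub0r => /eqP; rewrite oppr_eq0 oner_eq0.
rewrite rmorphB rmorphM /= map_polyX rmorph1 /root hornerD hornerN hornerM hornerX.
by rewrite -hp mulVf // hornerC subrr.
Qed.

Lemma exists_maximal_avoiding : ~ algebraicOver i b ->
  exists2 S, avoids S & forall S', avoids S' -> S `<=` S' -> S' `<=` S.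
Proof.
move=> /exists_avoiding [S0 hS0].
pose P : set (set K) := [set S | S = set0 \/ avoids S].
have [F FP Ft|S [PS Smax]] := @Zorn_bigcup _ P.
  have [[S FS aS]|nF] := pselect (exists2 S, F S & avoids S); last first.
    left; rewrite -subset0 => x [S FS Sx].
    by have [S0'|aS] := FP _ FS; [rewrite S0' in Sx | apply: nF; exists S].
  right; split.
  - by exists S => //; case: aS.
  - by move=> c; exists S => //; case: aS.
  - move=> f g [S1 F1 f1] [S2 F2 g2].
    have [h|h] := Ft _ _ F1 F2.
      have [e|[_ _ hB _ _]] := FP _ F2; first by rewrite e in g2.
      by exists S2 => //; apply: hB => //; exact: h.
    have [e|[_ _ hB _ _]] := FP _ F1; first by rewrite e in f1.
    by exists S1 => //; apply: hB => //; exact: h.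
  - move=> f g [S1 F1 f1] [S2 F2 g2].
    have [h|h] := Ft _ _ F1 F2.
      have [e|[_ _ _ hB _]] := FP _ F2; first by rewrite e in g2.
      by exists S2 => //; apply: hB => //; exact: h.
    have [e|[_ _ _ hB _]] := FP _ F1; first by rewrite e in f1.
    by exists S1 => //; apply: hB => //; exact: h.
  - case=> S1 F1 b1; have [e|[_ _ _ _ hb]] := FP _ F1; first by rewrite e in b1.
    exact: hb.
have aS : avoids S.
  case: PS => // S0'; exfalso; apply: (Smax S0); last by right.
  rewrite S0'; split; first exact: sub0set.
  by move=> h; have [hV _ _ _ _] := hS0; exact: h hV.
exists S => // S' aS' SS'; apply: contrapT => nS; apply: (Smax S'); last by right.
by split.
Qed.

Section Maximal.
Context (S : set K) (aS : avoids S).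
Context (Smax : forall S', avoids S' -> S `<=` S' -> S' `<=` S).

Let SV : S b^-1. Proof. by case: aS. Qed.
Let Si c : S (i c). Proof. by case: aS. Qed.
Let SB f g : S f -> S g -> S (f - g). Proof. by case: aS => _ _ h _ _; exact: h. Qed.
Let SM f g : S f -> S g -> S (f * g). Proof. by case: aS => _ _ _ h _; exact: h. Qed.
Let Sb : ~ S b. Proof. by case: aS. Qed.
Let S0 : S 0. Proof. by rewrite -(rmorph0 i). Qed.
Let S1 : S 1. Proof. by rewrite -(rmorph1 i). Qed.
Let SD f g : S f -> S g -> S (f + g).
Proof. by move=> hf hg; rewrite -[g]opprK; apply: SB => //; rewrite -sub0r; exact: SB. Qed.
Let Ssum n (f : nat -> K) : (forall j, S (f j)) -> S (\sum_(j < n) f j).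
Proof. by move=> h; elim/big_ind: _. Qed.
Let SX f n : S f -> S (f ^+ n).
Proof. by move=> h; elim: n => [|n IH]; rewrite ?expr0 // exprS; exact: SM. Qed.
Let b0 : b != 0.
Proof. by apply/eqP => b0; apply: Sb; rewrite b0. Qed.

(** The ring [S[x]] is strictly larger than [S] and still contains [b^-1] and the constants, so by
    maximality it must contain [b]. *)
Lemma maximal_adjoin x : ~ S x ->
  exists2 p : {poly K}, forall j, S p`_j & b = p.[x].
Proof.
move=> nSx; apply: contrapT => nb.
suff: [set f | exists2 p : {poly K}, forall j, S p`_j & f = p.[x]] `<=` S.
  move=> /(_ x) /= h; apply: nSx; apply: h; exists 'X; rewrite ?hornerX // => j.
  by rewrite coefX; case: eqP.
have SC c : S c -> forall j, S (c%:P : {poly K})`_j.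
  by move=> h j; rewrite coefC; case: eqP.
apply: Smax => [|f hf]; last by exists f%:P; [exact: SC|rewrite hornerC].
split=> [|c|f g [p hp ->] [p' hp' ->]|f g [p hp ->] [p' hp' ->]|//].
- by exists (b^-1)%:P; [exact: SC|rewrite hornerC].
- by exists (i c)%:P; [exact: SC|rewrite hornerC].
- exists (p - p'); last by rewrite hornerD hornerN.
  by move=> j; rewrite coefB; exact: SB.
- exists (p * p'); last by rewrite hornerM.
  move=> j; rewrite coefM.
  by apply: (Ssum _ (f := fun l => p`_l * p'`_(j - l))) => l; exact: SM.
Qed.

(** This places [b^-1] in the Jacobson radical of [S]. With [w = 1 - b^-1 * t] one has
    [b * w = b - t], so every [b * w ^+ n] is congruent to [b] modulo [S]; were [w^-1] outside [S],
    an expansion of [b] in [w^-1], multiplied by a high power of [w], would put [b] in [S]. *)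
Lemma maximal_inv t : S t -> S (1 - b^-1 * t)^-1.
Proof.
move=> St; set w := 1 - _.
have Sw : S w by apply: SB => //; exact: SM.
have w0 : w != 0.
  apply/eqP => /eqP; rewrite subr_eq0 => /eqP h; apply: Sb.
  by rewrite -[b]mulr1 h mulrA divff // mul1r.
apply: contrapT => /maximal_adjoin [p hp bp]; apply: Sb.
have Sbw n : S (b * w ^+ n - b).
  elim: n => [|n IH]; first by rewrite expr0 mulr1 subrr.
  have -> : b * w ^+ n.+1 - b = b * w ^+ n - b - t * w ^+ n.
    by rewrite exprSr /w; field.
  by apply: SB => //; apply: SM => //; exact: SX.
have: S (b * w ^+ size p).
  rewrite {1}bp horner_coef big_distrl /=.
  apply: (big_ind S) => // j _; rewrite -mulrA; apply: SM => //.
  have -> : w^-1 ^+ j * w ^+ size p = w ^+ (size p - j).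
    move: (nat_of_ord j) (ltnW (ltn_ord j)) => l hl.
    by rewrite -{1}(subnK hl) exprD mulrCA -exprMn mulVf // expr1n mulr1.
  exact: SX.
by move=> h; have := SB h (Sbw (size p)); rewrite opprB addrCA subrr addr0.
Qed.

(* Chevalley's exchange argument: of two expressions of [b], as a polynomial in *)
(* [x] and in [x^-1], the shorter one lowers the degree of the longer one.      *)
Lemma maximal_no_two_expansions N x n m (s t : nat -> K) : x != 0 ->
  (n + m <= N)%N -> (forall j, S (s j)) -> (forall j, S (t j)) ->
  b = \sum_(j < n.+1) s j * x ^+ j -> b = \sum_(j < m.+1) t j * x^-1 ^+ j -> False.
Proof.
elim: N x n m s t => [|N IH] x n m s t x0.
  rewrite leqn0 addn_eq0 => /andP[/eqP -> _] hs _.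
  by rewrite big_ord1 expr0 mulr1 => bs _; apply: Sb; rewrite bs.
wlog: x n m s t x0 / (m <= n)%N.
  move=> W; have [|/ltnW] := leqP m n; first exact: W.
  move=> nm hN hs ht bs bt; apply: (W x^-1 m n t s) => //.
  - by rewrite invr_eq0.
  - by rewrite addnC.
  - by rewrite invrK.
case: n => [|n] mn hN hs ht bs bt.
  by apply: Sb; rewrite bs big_ord1 expr0 mulr1.
pose t' j := if (j <= m)%N then t j else 0.
have ht' j : S (t' j) by rewrite /t'; case: ifP.
have bt' : b = \sum_(j < n.+2) t' j * x^-1 ^+ j.
  rewrite {1}bt (big_ord_widen n.+2 (fun j => t j * x^-1 ^+ j)) // big_mkcond.
  apply: eq_bigr => j _; rewrite /t' ltnS; case: ifP => // _; by rewrite mul0r.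
set u := (1 - b^-1 * t' 0%N)^-1.
have Su : S u by exact: maximal_inv.
have w0 : 1 - b^-1 * t' 0%N != 0.
  rewrite subr_eq0; apply/eqP => h; apply: Sb.
  by rewrite -[b]mulr1 h mulrA divff // mul1r.
have e1 : b = u * \sum_(j < n.+1) t' j.+1 * x^-1 ^+ j.+1.
  have : b - t' 0%N = \sum_(j < n.+1) t' j.+1 * x^-1 ^+ j.+1.
    by rewrite {1}bt' big_ord_recl expr0 mulr1 addrAC subrr add0r.
  move=> <-; apply: (mulfI w0); rewrite /u mulVKf // mulrBl mul1r mulrAC mulVf //.
  by rewrite mul1r.
(* Write the leading term as [s n.+1 * b^-1 * b * x ^+ n.+1] and substitute [e1] for [b]: since [e1]
   has only negative powers of [x], the degree drops to at most [n]. *)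
pose s' j := s j + s n.+1 * b^-1 * u * t' (n.+1 - j)%N.
apply: (IH x n m s' t) => //.
  by move=> j; apply: SD => //; do !apply: SM => //.
rewrite {1}bs big_ord_recr /=.
have -> : x ^+ n.+1 = b^-1 * b * x ^+ n.+1 by rewrite mulVf // mul1r.
rewrite {2}e1 !mulrA big_distrr big_distrl /=.
rewrite [X in _ + X](reindex_inj rev_ord_inj) /= -big_split /=.
apply: eq_bigr => j _; rewrite /s' mulrDl; congr (_ + _).
have jn : (j <= n)%N by rewrite -ltnS.
rewrite subSS -subSn //.
have -> : x ^+ n.+1 = x ^+ (n.+1 - j) * x ^+ j by rewrite -exprD subnK // ltnW.
have := mulVf (expf_neq0 (n.+1 - j) x0); rewrite -exprVn.
set X1 := x^-1 ^+ _; set X2 := x ^+ (n.+1 - j) => hX.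
rewrite !mulrA; set c := s n.+1 * _ * u * _.
by rewrite -[c * X1 * X2]mulrA hX mulr1.
Qed.

Lemma maximal_avoiding_valuation : is_valuation_ring i S.
Proof.
split=> [//|f g hf hg||f]; [by split; [exact: SB|exact: SM] | by exists b |].
have [|nf] := pselect (S f); first by left.
have [|nfV] := pselect (S f^-1); first by right.
have f0 : f != 0 by apply/eqP => f0; apply: nf; rewrite f0.
have [p hp bp] := maximal_adjoin nf; have [p' hp' bp'] := maximal_adjoin nfV.
have hor (r : {poly K}) x : r.[x] = \sum_(j < (size r).+1) r`_j * x ^+ j.
  by rewrite (@horner_coef_wide _ (size r).+1).
exfalso; apply: (@maximal_no_two_expansions _ f (size p) (size p')
  (nth 0 p) (nth 0 p') f0 (leqnn _) hp hp'); first by rewrite {1}bp hor.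
by rewrite {1}bp' hor.
Qed.

End Maximal.

Lemma transcendental_valuation_ring : ~ algebraicOver i b ->
  exists2 O, is_valuation_ring i O & ~ O b.
Proof.
move=> /exists_maximal_avoiding [S aS Smax]; exists S; last by case: aS.
exact: maximal_avoiding_valuation.
Qed.

End Chevalley.

(** If [f] had no pole at infinity, a valuation ring omitting [f] would differ from the ring at
    infinity, and regularity would force it to contain [f]. *)
Lemma regular_away_pole (X : pointed_curve) (f : Kf X) : f \in regular_away X ->
  ~ algebraicOver (Fq_to_K X) f -> ord_infty X f < 0.
Proof.
move=> /asboolP hf tf; rewrite ltNge; apply/negP => vf.
have [O vO nO] := transcendental_valuation_ring tf.
by apply: (nO); apply: hf => // e; apply: nO; rewrite e.
Qed.

(** * Decay of a twisted recursion *)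

Section Ultrametric.
Context {RR : realType} {F : fieldType} (a : F -> RR) (ha : is_abs a).

Lemma abs_ge0 x : 0 <= a x. Proof. by case: ha. Qed.
Lemma abs0 : a 0 = 0. Proof. by have [_ h _ _] := ha; apply/eqP; rewrite h. Qed.
Lemma absM x y : a (x * y) = a x * a y. Proof. by case: ha. Qed.
Lemma abs_neq0 x : x != 0 -> a x != 0. Proof. by have [_ h _ _] := ha; rewrite h. Qed.

Lemma abs1 : a 1 = 1.
Proof.
by apply: (mulfI (abs_neq0 (oner_neq0 F))); rewrite -absM !mulr1.
Qed.

Lemma absX x n : a (x ^+ n) = a x ^+ n.
Proof. by elim: n => [|n IH]; rewrite ?expr0 ?abs1 // !exprS absM IH. Qed.

Lemma absD_le x y c : a x <= c -> a y <= c -> a (x + y) <= c.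
Proof.
move=> hx hy; have [_ _ _ h] := ha; apply: le_trans (h x y) _.
by rewrite ge_max hx hy.
Qed.

Lemma abs_sum_le (I : Type) (r : seq I) (P : pred I) (f : I -> F) c : 0 <= c ->
  (forall j, P j -> a (f j) <= c) -> a (\sum_(j <- r | P j) f j) <= c.
Proof.
move=> c0 h; elim/big_rec: _ => [|j x Pj hx]; first by rewrite abs0.
by apply: absD_le => //; exact: h.
Qed.

Lemma abs_frob_sub t n : 1 < a t -> (1 < n)%N -> a t ^+ n <= a (t ^+ n - t).
Proof.
move=> t1 n1; rewrite leNgt; apply/negP => h.
have hn : a t < a t ^+ n by rewrite -{1}[a t]expr1 ltr_eXn2l.
have [_ _ _ /(_ (t ^+ n - t) t)] := ha.
by rewrite subrK absX leNgt gt_max h hn.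
Qed.

End Ultrametric.

Lemma pow_unbounded (R : realType) (s x : R) : 1 < s ->
  exists n0, forall n, (n0 <= n)%N -> x < s ^+ n.
Proof.
move=> s1; have bern n : 1 + n%:R * (s - 1) <= s ^+ n.
  elim: n => [|n IH]; first by rewrite mul0r addr0 expr0.
  rewrite exprSr; apply: (@le_trans _ _ ((1 + n%:R * (s - 1)) * s)).
    have : 0 <= n%:R * (s - 1) ^+ 2 by rewrite mulr_ge0 ?ler0n ?sqr_ge0.
    rewrite -natr1; set u := n%:R; nra.
  by apply: ler_wpM2r => //; lra.
exists (Num.bound `|x / (s - 1)|) => n hn; apply: lt_le_trans (bern n).
have s0 : 0 < s - 1 by lra.
suff : x < n%:R * (s - 1) by lra.
rewrite -ltr_pdivrMr //; apply: le_lt_trans (ler_norm _) _.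
apply: lt_le_trans (archi_boundP (normr_ge0 _)) _.
by rewrite ler_nat.
Qed.

Section Recursion.
Context {RR : realType} {F : fieldType} (a : F -> RR) (ha : is_abs a).

Lemma exists_entry_bound p r (B : nat -> 'M[F]_(p, r)) N :
  exists2 c : RR, 1 <= c & forall n, (n < N)%N -> forall k l, a (B n k l) <= c.
Proof.
have s0 n : 0 <= \sum_k \sum_l a (B n k l).
  by do 2!apply: sumr_ge0 => ? _; exact: abs_ge0.
elim: N => [|N [c c1 hc]]; first by exists 1.
exists (c + \sum_k \sum_l a (B N k l)); first by have := s0 N; lra.
move=> n; rewrite ltnS leq_eqVlt => /orP[/eqP ->|/hc h] k l; last first.
  by have := s0 N; have := h k l; lra.
apply: (@le_trans _ _ (\sum_k \sum_l a (B N k l))); last by lra.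
rewrite (bigD1 k) //= (bigD1 l) //= -addrA lerDl; apply: addr_ge0.
  by apply: sumr_ge0 => ? _; exact: abs_ge0.
by do 2!apply: sumr_ge0 => ? _; exact: abs_ge0.
Qed.

Context (q d D : nat) (q1 : (1 < q)%N) (t : F) (t1 : 1 < a t).
Context (A Q : nat -> 'M[F]_d).
Hypothesis hA : forall i, (D < i)%N -> A i = 0.
Hypothesis hQ : forall n, (0 < n)%N ->
  (t ^+ (q ^ n) - t) *: Q n =
  \sum_(i < n) A i.+1 *m map_mx (fun x => x ^+ (q ^ i.+1)) (Q (n - i.+1)%N).

Let s : RR := Num.sqrt (a t).
Let s1 : 1 < s. Proof. by rewrite -[1]sqrtr1 ltr_sqrt // (lt_trans ltr01 t1). Qed.
Let s_sq : s ^+ 2 = a t. Proof. by rewrite sqr_sqrtr // abs_ge0. Qed.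
Let s_gt0 : 0 < s. Proof. exact: lt_trans ltr01 s1. Qed.

(* If [|Q_m| <= r ^ (q ^ m)] for the [D] indices before [n], then one of the two *)
(* factors [s ^ (q ^ n)] of [|t| ^ (q ^ n)] absorbs [|A_i|], and the other       *)
(* improves [r] to [r / s] at [n].                                               *)
Lemma recursion_step c r n : (0 < n)%N -> 0 <= r -> 1 <= c -> c <= s ^+ (q ^ n) ->
  (forall i k l, a (A i k l) <= c) ->
  (forall m, (m < n)%N -> (n - m <= D)%N -> forall k l, a (Q m k l) <= r ^+ (q ^ m)) ->
  forall k l, a (Q n k l) <= (r / s) ^+ (q ^ n).
Proof.
move=> n0 r0 c1 ct hc IH k l.
have sn0 : 0 < s ^+ (q ^ n) by exact: exprn_gt0.
have qn1 : (1 < q ^ n)%N by rewrite -{1}(exp1n n) ltn_exp2r.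
have le1 : (s ^+ (q ^ n)) ^+ 2 * a (Q n k l) <= c * r ^+ (q ^ n).
  have := congr1 (fun M : 'M_d => a (M k l)) (hQ n0); rewrite /= mxE (absM ha) => e.
  apply: (@le_trans _ _ (a (t ^+ (q ^ n) - t) * a (Q n k l))).
    apply: ler_wpM2r; first exact: abs_ge0.
    by rewrite -exprM mulnC exprM s_sq abs_frob_sub.
  rewrite e; have cr0 : 0 <= c * r ^+ (q ^ n).
    by apply: mulr_ge0; [exact: le_trans ler01 c1|exact: exprn_ge0].
  rewrite summxE; apply: abs_sum_le => // i _; rewrite mxE; apply: abs_sum_le => // j _.
  have [Di|iD] := ltnP D i.+1; first by rewrite hA // mxE mul0r abs0.
  rewrite mxE (absM ha) (absX ha); apply: ler_pM; rewrite ?exprn_ge0 ?abs_ge0 //.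
  have hin : (i.+1 <= n)%N by [].
  have -> : r ^+ (q ^ n) = (r ^+ (q ^ (n - i.+1))) ^+ (q ^ i.+1).
    by rewrite -exprM -expnD subnK.
  apply: lerXn2r; rewrite ?nnegrE ?(abs_ge0 ha) ?exprn_ge0 //.
  by apply: IH; rewrite ?subKn // ltn_subrL.
rewrite expr_div_n ler_pdivlMr // -(ler_pM2l sn0).
apply: le_trans (_ : c * r ^+ (q ^ n) <= _).
  by apply: le_trans le1; rewrite expr2 [X in _ * X <= _]mulrC mulrA.
by apply: ler_wpM2r => //; exact: exprn_ge0.
Qed.

(** Induction on [e]: every further block of [D.+1] indices allows one more use of [recursion_step],
    hence one more division of the base by [s]. The case [e = 0] is the crude bound [B ^+ (q ^ n)],
    itself obtained from [recursion_step] by dropping the gain. *)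
Lemma recursion_decay c n1 B : 1 <= c -> (forall i k l, a (A i k l) <= c) ->
  (forall n, (n1 <= n)%N -> c <= s ^+ (q ^ n)) ->
  1 <= B -> (forall n, (n <= n1)%N -> forall k l, a (Q n k l) <= B) ->
  forall e n, (n1 + e * D.+1 <= n)%N ->
  forall k l, a (Q n k l) <= (B / s ^+ e) ^+ (q ^ n).
Proof.
move=> c1 hc hn1 B1 hB; have B0 : 0 <= B by exact: le_trans ler01 B1.
have decay0 n k l : a (Q n k l) <= B ^+ (q ^ n).
  elim/ltn_ind: n k l => n IH k l; have [le_n|lt_n] := leqP n n1.
    apply: le_trans (hB n le_n k l) _; rewrite -{1}[B]expr1.
    by apply: ler_weXn2l => //; rewrite expn_gt0 (ltnW q1).
  apply: (@le_trans _ _ ((B / s) ^+ (q ^ n))).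
    apply: (recursion_step _ B0 c1) => //; first exact: leq_ltn_trans lt_n.
      by apply: hn1; exact: ltnW.
    by move=> m mn _; exact: IH.
  apply: lerXn2r; rewrite ?nnegrE ?divr_ge0 ?(ltW s_gt0) //.
  by rewrite ler_pdivrMr // ler_peMr // ltW.
elim=> [|e IH] n hn; first by rewrite expr0 divr1 => k l; exact: decay0.
rewrite exprSr invfM mulrA; apply: (recursion_step _ _ c1) => //.
- by move: hn; lia.
- by rewrite divr_ge0 // exprn_ge0 // ltW.
- by apply: hn1; move: hn; lia.
- by move=> m mn nm; apply: IH; move: hn nm; rewrite mulSn; move: (e * _)%N; lia.
Qed.

(** With [R] bounding the entries of [z], take [e] such that [s ^+ e] exceeds [2 * (B * R)]; the
    n-th term is then eventually at most [2^-1 ^+ (q ^ n)]. *)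
Lemma recursion_entire (z : 'cV[F]_d) k :
  abs_cvg a (fun n => (Q n *m map_mx (fun x => x ^+ (q ^ n)) z) k 0) 0.
Proof.
have [c c1 hc0] := exists_entry_bound A D.+1.
have hc i k' l : a (A i k' l) <= c.
  have [Di|iD] := ltnP D i; last exact: hc0.
  by rewrite hA // mxE abs0 //; exact: le_trans ler01 c1.
have le_qn n : (n <= q ^ n)%N by apply: ltnW; exact: ltn_expl.
have [n1 hn1] := pow_unbounded c s1.
have [B B1 hB] := exists_entry_bound Q n1.+1.
have [R R1 hR] := exists_entry_bound (fun=> z) 1.
have B0 : 0 <= B by exact: le_trans ler01 B1.
have R0 : 0 <= R by exact: le_trans ler01 R1.
have [e he] := pow_unbounded (2 * (B * R)) s1.
have {}he := he e (leqnn e).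
move=> eps eps0; have [n2 hn2] := @pow_unbounded _ 2 eps^-1 ltac:(by rewrite ltr1n).
exists (n1 + e * D.+1 + n2)%N => n hn; rewrite subr0.
have hs m : (n1 <= m)%N -> c <= s ^+ (q ^ m).
  by move=> hm; apply: ltW; apply: hn1; exact: leq_trans hm _.
have hdec : forall k l, a (Q n k l) <= (B / s ^+ e) ^+ (q ^ n).
  by apply: (recursion_decay c1 hc hs B1 hB); move: hn; lia.
have half_lt : (2^-1 : RR) ^+ (q ^ n) < eps.
  rewrite exprVn -[eps]invrK ltf_pV2 ?posrE ?invr_gt0 ?exprn_gt0 //.
  by apply: hn2; apply: leq_trans (le_qn n); move: hn; lia.
apply: le_lt_trans half_lt.
have h0 : 0 <= (2^-1 : RR) ^+ (q ^ n) by rewrite exprn_ge0 // invr_ge0.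
rewrite mxE; apply: (abs_sum_le ha) => // l _.
rewrite mxE (absM ha) (absX ha).
apply: (@le_trans _ _ ((B / s ^+ e) ^+ (q ^ n) * R ^+ (q ^ n))).
  apply: ler_pM; rewrite ?exprn_ge0 ?abs_ge0 //.
  by apply: lerXn2r; rewrite ?nnegrE ?(abs_ge0 ha) // (hR 0%N).
rewrite -exprMn; apply: lerXn2r.
- by rewrite nnegrE mulr_ge0 // divr_ge0 // exprn_ge0 // ltW.
- by rewrite nnegrE invr_ge0.
rewrite mulrAC ler_pdivrMr ?exprn_gt0 //; move: he; set u := s ^+ e; lra.
Qed.

End Recursion.

(** * Localization of modules *)

Section FractionExtension.
Context {R : comNzRingType} (Q : frac_field R).

Lemma frac_map_neq0 (r : R) : r != 0 -> frac_map Q r != 0.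
Proof. by rewrite -(rmorph0 (frac_map Q)) (inj_eq (@frac_map_inj _ Q)). Qed.

Lemma frac_mul_neq0 (r s : R) : r != 0 -> s != 0 -> r * s != 0.
Proof.
move=> /frac_map_neq0 hr /frac_map_neq0 hs; have := mulf_neq0 hr hs.
by rewrite -rmorphM -(rmorph0 (frac_map Q)) (inj_eq (@frac_map_inj _ Q)).
Qed.

Context (theta : {rmorphism R -> R}) (theta_inj : injective theta).

Let theta_neq0 (r : R) : r != 0 -> theta r != 0.
Proof. by apply: contra_neq => h; apply: theta_inj; rewrite rmorph0. Qed.

Lemma frac_ext_div (r s : R) : s != 0 ->
  frac_ext theta (frac_map Q r / frac_map Q s) =
  frac_map Q (theta r) / frac_map Q (theta s).
Proof.
move=> s0; rewrite /frac_ext; case: xgetP => [[r' s'] _ /= [s'0 e]|/(_ (r, s))].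
  apply/eqP; rewrite eqr_div ?frac_map_neq0 ?theta_neq0 //.
  move/eqP: e; rewrite eqr_div ?frac_map_neq0 // -!rmorphM => /eqP /frac_map_inj e.
  by rewrite e.
by case.
Qed.

Lemma frac_ext_map r : frac_ext theta (frac_map Q r) = frac_map Q (theta r).
Proof.
by rewrite -[frac_map Q r]divr1 -(rmorph1 (frac_map Q)) frac_ext_div ?oner_neq0 //
  !rmorph1 divr1.
Qed.

Lemma frac_extD : {morph frac_ext theta : f g / f + g :> Q}.
Proof.
move=> f g; have [r [s [s0 ->]]] := frac_mapP f; have [r' [s' [s'0 ->]]] := frac_mapP g.
rewrite !frac_ext_div // !addf_div ?frac_map_neq0 ?theta_neq0 //.
by rewrite -!rmorphM -!rmorphD frac_ext_div ?frac_mul_neq0 // !rmorphD !rmorphM.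
Qed.

Lemma frac_extM : {morph frac_ext theta : f g / f * g :> Q}.
Proof.
move=> f g; have [r [s [s0 ->]]] := frac_mapP f; have [r' [s' [s'0 ->]]] := frac_mapP g.
rewrite !frac_ext_div // !mulf_div -!rmorphM.
by rewrite frac_ext_div ?frac_mul_neq0 // !rmorphM.
Qed.

End FractionExtension.

Section ExtendedModule.
Context {R : comNzRingType} (Q : frac_field R) (U : lmodType R).
Local Notation pure := (@extQ_pure R Q U).

Let pure_balanced := tensor_pure_balanced (fun (r : R) (u : U) => r *: u)
  (fun (r : R) (g : Q) => frac_map Q r * g).

Lemma extQ_pureDl f : {morph pure^~ f : u v / u + v}.
Proof. by have [h _ _] := pure_balanced; exact: h. Qed.

Lemma extQ_pureDr u : {morph pure u : f g / f + g}.
Proof. by have [_ h _] := pure_balanced; exact: h. Qed.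

Lemma extQ_pureBr u : {morph pure u : f g / f - g}.
Proof. by move=> f g; apply: (addIr (pure u g)); rewrite -extQ_pureDr !subrK. Qed.

Lemma extQ_pureZ r u f : pure (r *: u) f = pure u (frac_map Q r * f).
Proof. by have [_ _ h] := pure_balanced; exact: h. Qed.

Lemma extQ_scaleE f u g : f *: pure u g = pure u (f * g).
Proof. exact: extQ_scale_pure. Qed.

Lemma extQ_pure0 f : pure 0 f = 0.
Proof. by apply: (addrI (pure 0 f)); rewrite -extQ_pureDl !addr0. Qed.

Lemma extQ_pureB f : {morph pure^~ f : u v / u - v}.
Proof. by move=> u v; apply: (addIr (pure v f)); rewrite -extQ_pureDl !subrK. Qed.

Lemma extQ_pure_sum (I : Type) (r : seq I) (P : pred I) (F : I -> U) f :
  pure (\sum_(i <- r | P i) F i) f = \sum_(i <- r | P i) pure (F i) f.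
Proof. exact: (big_morph _ (extQ_pureDl f) (extQ_pure0 f)). Qed.

Lemma extQ_frac_scale r u : frac_map Q r *: pure u 1 = pure (r *: u) 1.
Proof. by rewrite extQ_scaleE extQ_pureZ. Qed.

Lemma extQ_repr (x : extQ Q U) :
  exists u s, s != 0 /\ x = pure u (frac_map Q s)^-1.
Proof.
move: x; apply: tensor_ind => [|u f|x y [u [s [s0 ->]]] [v [t [t0 ->]]]].
- by exists 0, 1; rewrite extQ_pure0 oner_neq0.
- have [r [s [s0 ->]]] := frac_mapP f.
  by exists (r *: u), s; rewrite extQ_pureZ.
- have h := frac_mul_neq0 Q s0 t0.
  exists (t *: u + s *: v), (s * t); split=> //.
  have fs := frac_map_neq0 Q s0; have ft := frac_map_neq0 Q t0.
  rewrite extQ_pureDl !extQ_pureZ rmorphM /= invfM; congr (pure u _ + pure v _).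
    by rewrite mulrCA divff // mulr1.
  by rewrite mulVKf.
Qed.

(** Projectivity splits a surjection from a free module onto U by a map [h]; the coordinates of [h]
    extend to a map from the extension of U to Q^n, and R embeds in Q. *)
Lemma extQ_pure_inj : is_fin_gen U -> is_projective U -> injective (pure^~ 1).
Proof.
move=> [n [e he]] hproj.
pose g (c : 'rV[R]_n) : U := \sum_(i < n) c 0 i *: e i.
have g_lin : linear g.
  move=> r c c'; rewrite /g scaler_sumr -big_split /=; apply: eq_bigr => i _.
  by rewrite !mxE scalerDl scalerA.
pose gL := GRing.isLinear.Build R _ _ _ g g_lin.
pose gl : {linear 'rV[R]_n -> U} := HB.pack g gL.
have [w|h hh] := hproj 'rV[R]_n U gl idfun.
  by have [c ->] := he w; exists (\row_i c i); apply: eq_bigr => i _; rewrite mxE.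
pose b (u : U) (f : Q) : 'rV[Q]_n := \row_i (frac_map Q (h u 0 i) * f).
have hb : balanced (fun (r : R) (u : U) => r *: u)
    (fun (r : R) (g : Q) => frac_map Q r * g) b.
  split=> [v x y|u x y|r u f]; apply/rowP => i; rewrite !mxE.
  - by rewrite linearD mxE rmorphD mulrDl.
  - by rewrite mulrDr.
  - by rewrite linearZ mxE rmorphM [RHS]mulrCA mulrA.
move=> u v /(congr1 (tensor_lift b)); rewrite !tensor_lift_pure // => /rowP e'.
have huv : h u = h v.
  by apply/rowP => i; have := e' i; rewrite !mxE !mulr1 => /frac_map_inj.
by have := hh u; rewrite huv hh.
Qed.

End ExtendedModule.

Section Span.
Context {V : zmodType}.

Lemma add_span_ind (S P : set V) : P 0 -> (forall x y, P x -> P y -> P (x + y)) ->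
  S `<=` P -> add_span S `<=` P.
Proof.
move=> P0 PD SP x [s hs ->]; rewrite big_seq.
by elim/big_ind: _ => // y /hs /SP.
Qed.

Lemma sub_add_span (S : set V) : S `<=` add_span S.
Proof.
move=> x Sx; exists [:: x]; last by rewrite big_seq1.
by move=> y; rewrite inE => /eqP ->.
Qed.

Lemma add_span0 (S : set V) : add_span S 0.
Proof. by exists [::]; rewrite ?big_nil. Qed.

Lemma add_spanD (S : set V) x y : add_span S x -> add_span S y -> add_span S (x + y).
Proof.
move=> [s hs ->] [t ht ->]; exists (s ++ t); last by rewrite big_cat.
by move=> z; rewrite mem_cat => /orP[/hs|/ht].
Qed.

End Span.

Lemma add_span_map (V V' : zmodType) (f : V -> V') (S : set V) (S' : set V') :
  {morph f : x y / x + y} -> (forall x, S x -> S' (f x)) ->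
  forall x, add_span S x -> add_span S' (f x).
Proof.
move=> fD fS; apply: (@add_span_ind _ S [set x | add_span S' (f x)])
  => [|x y hx hy|x /fS h] /=;
  last exact: sub_add_span.
  suff -> : f 0 = 0 by exact: add_span0.
  by apply: (addrI (f 0)); rewrite -fD !addr0.
by rewrite fD; exact: add_spanD.
Qed.

Lemma add_spanS (V : zmodType) (S S' : set V) : S `<=` S' -> add_span S `<=` add_span S'.
Proof. by move=> h x; apply: (add_span_map (f := id)). Qed.

(* [J] is the kernel of a retraction [ev] of [R] onto a subfield: modulo [J^n], *)
(* a denominator [s] outside [J] is [ev s * (1 - j)] with [j] in [J], and       *)
(* [1 - j] is inverted by a truncated geometric series.                         *)
Section Localize.
Context {R : comNzRingType} (Q : frac_field R) (U : lmodType R).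
Context (F : fieldType) (ev : {rmorphism R -> F}) (sec : F -> R).
Context (secK : cancel sec ev) (J : set R) (JE : forall x, J x <-> ev x = 0).
Context (hinj : injective ((@extQ_pure R Q U)^~ 1)).
Local Notation pure := (@extQ_pure R Q U).
Local Notation MJ := (loc_module (~` J) : set (extQ Q U)).
Local Notation JnM n := (ideal_mul (ideal_pow J n) [set: U]).
Local Notation JnMJ n := (add_span [set x : extQ Q U | exists j y,
    [/\ ideal_pow J n j, MJ y & x = frac_map Q j *: y]]).

Lemma notJ s : (~` J) s <-> ev s != 0.
Proof.
split=> [h|/eqP h]; last by move=> /JE.
by apply/eqP => e; apply: h; apply/JE.
Qed.

Let notJ_neq0 s : (~` J) s -> s != 0.
Proof. by move=> /notJ; apply: contra_neq => ->; rewrite rmorph0. Qed.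

Lemma ideal_pow_mull n r x : ideal_pow J n x -> ideal_pow J n (r * x).
Proof.
case: n => [//|n]; apply: add_span_map => [y z|y [j [s [Jj Js ->]]]].
  exact: mulrDr.
exists (r * j), s; split=> //; last by rewrite mulrA.
by apply/JE; rewrite rmorphM (JE j).1 // mulr0.
Qed.

Lemma ideal_powX n j : J j -> ideal_pow J n (j ^+ n).
Proof.
move=> Jj; elim: n => [//|n IH]; apply: sub_add_span.
by exists j, (j ^+ n); rewrite exprS.
Qed.

Lemma ideal_pow_leq m n : (m <= n)%N -> ideal_pow J n `<=` ideal_pow J m.
Proof.
elim: n m => [|n IH] [|m] //; rewrite ltnS => mn; apply: add_spanS.
by move=> _ [j [s [Jj Js ->]]]; exists j, s; split=> //; exact: IH Js.
Qed.

Lemma JnMZ n r u : JnM n u -> JnM n (r *: u).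
Proof.
apply: add_span_map => [y z|_ [j [v [Jj _ ->]]]]; first exact: scalerDr.
by exists (r * j), v; split=> //; [exact: ideal_pow_mull|rewrite scalerA].
Qed.

Lemma JnMJZ n r x : JnMJ n x -> JnMJ n (frac_map Q r *: x).
Proof.
apply: add_span_map => [y z|_ [j [v [Jj Jv ->]]]]; first exact: scalerDr.
exists (r * j), v; split=> //; first exact: ideal_pow_mull.
by rewrite scalerA rmorphM.
Qed.

Lemma JnMJN n x : JnMJ n x -> JnMJ n (- x).
Proof. by move=> /(@JnMJZ n (-1)); rewrite rmorphN1 scaleN1r. Qed.

Lemma JnMJ_leq m n : (m <= n)%N -> JnMJ n `<=` JnMJ m.
Proof.
move=> mn; apply: add_spanS => _ [j [v [Jj Jv ->]]]; exists j, v; split=> //.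
exact: ideal_pow_leq Jj.
Qed.

Lemma JnMJ_clear n x : JnMJ n x ->
  exists s u, [/\ ev s != 0, JnM n u & frac_map Q s *: x = pure u 1].
Proof.
move: x; apply: add_span_ind => [|x y [s [u [s0 Ju e]]] [t [v [t0 Jv e']]]|].
- exists 1, 0; rewrite rmorph1 oner_neq0 scaler0 extQ_pure0; split=> //.
  exact: add_span0.
- exists (s * t), (t *: u + s *: v); rewrite rmorphM mulf_neq0 //; split=> //.
    by apply: add_spanD; exact: JnMZ.
  rewrite extQ_pureDl -!extQ_frac_scale -e -e' !scalerA scalerDr -!rmorphM.
  by rewrite [t * s]mulrC.
- move=> _ [j [_ [Jj [u [s [Js ->]]] ->]]].
  exists s, (j *: u); split; first exact/notJ.
    by apply: sub_add_span; exists j, u.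
  rewrite -extQ_frac_scale !extQ_scaleE mulr1; congr (pure u _).
  by rewrite mulrCA divff ?mulr1 // frac_map_neq0 // notJ_neq0.
Qed.

(** Injectivity of M / J^n M -> M_J / J^n M_J: clear denominators, then divide by the unit [1 - j]
    modulo J^n. *)
Lemma JnMJ_pure n u : JnMJ n (pure u 1) -> JnM n u.
Proof.
move=> /JnMJ_clear [s [v [s0 Jv]]]; rewrite extQ_frac_scale => /hinj e.
pose j := 1 - sec (ev s)^-1 * s.
have Jj : J j by apply/JE; rewrite rmorphB rmorph1 rmorphM secK mulVf // subrr.
have h : JnM n ((1 - j) *: u).
  by rewrite /j subKr -scalerA e; exact: JnMZ.
have -> : u = (\sum_(i < n) j ^+ i) *: ((1 - j) *: u) + j ^+ n *: u.
  rewrite scalerA -scalerDl mulrC -[1 - j]opprB mulNr -subrX1 opprB subrK.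
  by rewrite scale1r.
apply: add_spanD; first exact: JnMZ.
by apply: sub_add_span; exists (j ^+ n), u; split=> //; exact: ideal_powX.
Qed.

(** Surjectivity of M / J^n M -> M_J / J^n M_J. *)
Lemma MJ_approx n x : MJ x -> exists u, JnMJ n (x - pure u 1).
Proof.
move=> [u [s [Js ->]]]; have s0 := (notJ s).1 Js.
pose j := 1 - sec (ev s)^-1 * s.
have Jj : J j by apply/JE; rewrite rmorphB rmorph1 rmorphM secK mulVf // subrr.
exists ((sec (ev s)^-1 * \sum_(i < n) j ^+ i) *: u).
apply: sub_add_span; exists (j ^+ n), (pure u (frac_map Q s)^-1); split.
- exact: ideal_powX.
- by exists u, s.
have fs := frac_map_neq0 Q (notJ_neq0 Js).
rewrite extQ_pureZ extQ_scaleE mulr1 -extQ_pureBr; congr (pure u _).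
have -> : j ^+ n = 1 - (1 - j) * (\sum_(i < n) j ^+ i).
  by rewrite -[1 - j]opprB mulNr -subrX1 opprB subKr.
move: (\sum_(i < n) _) => S; rewrite {1}/j subKr rmorphB rmorph1 mulrBl mul1r.
by rewrite mulrAC [X in _ = _ - X / _]rmorphM mulfK.
Qed.

End Localize.

(** * The motive and the inverse of tau *)

Section Evaluation.
Context {X : pointed_curve} (E : coef_field X).
Local Notation L := (L E).
Local Notation A := (Aring X).

Definition A_to_L (a : A) : L := K_to_L E (A_val a).

Lemma A_to_LD : {morph A_to_L : a b / a + b}.
Proof. by move=> a b; rewrite /A_to_L -rmorphD. Qed.
Lemma A_to_LM : {morph A_to_L : a b / a * b}.
Proof. by move=> a b; rewrite /A_to_L -rmorphM. Qed.
Lemma A_to_L1 : A_to_L 1 = 1.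
Proof. by rewrite /A_to_L -[RHS](rmorph1 (K_to_L E)). Qed.
Lemma A_to_LX a n : A_to_L (a ^+ n) = A_to_L a ^+ n.
Proof. by elim: n => [|n IH]; rewrite ?expr0 ?A_to_L1 // !exprS A_to_LM IH. Qed.

(** Evaluation at the point Xi, with residue field L; its kernel is J by [Jideal0E]. *)
Definition ev_Xi : LA E -> L := LA_lift (fun l a => l * A_to_L a).

Lemma ev_Xi_balanced : LA_balanced (fun (l : L) (a : A) => l * A_to_L a).
Proof.
split=> [a x y|l x y|c l a]; rewrite ?mulrDl ?A_to_LD ?mulrDr //.
by rewrite A_to_LM mulrCA mulrA.
Qed.

Lemma ev_Xi_tens l a : ev_Xi (tens E l a) = l * A_to_L a.
Proof. exact: LA_lift_tens ev_Xi_balanced. Qed.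

Lemma ev_XiD : {morph ev_Xi : x y / x + y}.
Proof. exact: LA_liftD ev_Xi_balanced. Qed.

Fact ev_Xi_zmod_morphism : zmod_morphism ev_Xi.
Proof. by move=> x y; apply: (addIr (ev_Xi y)); rewrite -ev_XiD !subrK. Qed.

Fact ev_Xi_monoid_morphism : monoid_morphism ev_Xi.
Proof.
split=> [|x y]; first by rewrite [LHS]ev_Xi_tens A_to_L1 mulr1.
move: x; apply: LA_ext => [x x'|x x'|l a]; rewrite ?mulrDl ?ev_XiD ?mulrDl //.
move: y; apply: LA_ext => [x x'|x x'|l' a']; rewrite ?mulrDr ?ev_XiD ?mulrDr //.
by rewrite tensM !ev_Xi_tens A_to_LM mulrACA.
Qed.

HB.instance Definition _ :=
  GRing.isZmodMorphism.Build (LA E) L ev_Xi ev_Xi_zmod_morphism.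
HB.instance Definition _ :=
  GRing.isMonoidMorphism.Build (LA E) L ev_Xi ev_Xi_monoid_morphism.

Lemma tensDl a : {morph (tens E)^~ a : x y / x + y}.
Proof. by have [h _ _] := tens_balanced E; exact: h. Qed.

Lemma ev_XiK : cancel (fun l => tens E l 1) ev_Xi.
Proof. by move=> l; rewrite ev_Xi_tens A_to_L1 mulr1. Qed.

Lemma Jideal0E x : Jideal E 0 x <-> ev_Xi x = 0.
Proof.
split=> [|h].
  move: x; apply: (@add_span_ind _ _ [set x | ev_Xi x = 0]) => [|x y|] /=.
  - exact: rmorph0.
  - by rewrite rmorphD /= => -> ->; rewrite addr0.
  - move=> _ [r [_ [[a ->] ->]]] /=; rewrite rmorphM rmorphB /= !ev_Xi_tens expn0 expr1.
    by rewrite A_to_L1 mulr1 mul1r subrr mulr0.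
(* Every [x] is congruent to [ev_Xi x (x) 1] modulo J; on a pure tensor the difference is
   [(l (x) 1) (1 (x) a - a (x) 1)]. *)
suff: Jideal E 0 (x - tens E (ev_Xi x) 1).
  rewrite h; suff -> : tens E 0 1 = 0 by rewrite subr0.
  by apply: (addrI (tens E 0 1)); rewrite -tensDl !addr0.
move: x {h}; apply: tensor_ind => [|l a|x y hx hy].
- rewrite rmorph0 (_ : tens E 0 1 = 0) ?subrr; first exact: add_span0.
  by apply: (addrI (tens E 0 1)); rewrite -tensDl !addr0.
- apply: sub_add_span; exists (tens E l 1), (tens E 1 a - tens E (A_to_L a) 1).
  split; first by exists a; rewrite qpow0.
  by rewrite mulrBr !tensM mulr1 mul1r mulr1 [ev_Xi _]ev_Xi_tens.
- rewrite rmorphD tensDl opprD addrACA; exact: add_spanD.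
Qed.

Lemma twist_twist i j x : @twist X E i (twist j x) = twist (i + j) x.
Proof.
move: x; apply: LA_ext => [x y|x y|l a]; rewrite ?rmorphD //.
by rewrite !twist_tens qpowD.
Qed.

Lemma twist0 x : @twist X E 0 x = x.
Proof.
move: x; apply: LA_ext => [x y|//|l a]; first by rewrite rmorphD.
by rewrite twist_tens qpow0.
Qed.

Lemma twistK i : cancel (@twist X E i) (twist (- i)).
Proof. by move=> x; rewrite twist_twist addNr twist0. Qed.

Lemma twistNK i : cancel (@twist X E (- i)) (twist i).
Proof. by move=> x; rewrite -{1}[i]opprK twistK. Qed.

Lemma iter_twist n i x : iter n (@twist X E i) x = twist (i *+ n) x.
Proof. by elim: n => [|n IH] /=; rewrite ?twist0 // IH twist_twist mulrS. Qed.

End Evaluation.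

(** * The action of tau on M and M_Q, and its inverse *)

Section Motive.
Context {X : pointed_curve} {E : coef_field X} (Q : frac_field (LA E)).
Context {d : nat} (phi : anderson_module E d).
Local Notation L := (L E).
Local Notation A := (Aring X).
Local Notation M := (motive phi).
Local Notation MQ := (extQ Q M).
Local Notation pure m := (@extQ_pure (LA E) Q M m 1).

Lemma motive_tens_scale l a (m : M) :
  tens E l a *: m = skewC _ l *: ((m : 'rV[Ltau E]_d) *m phi a) :> 'rV[Ltau E]_d.
Proof. exact: (LA_scale_tens (motive_actions phi)). Qed.

Lemma skew_coefXM (theta : {rmorphism L -> L}) (p : skewpoly theta) n :
  skew_coef (skewX theta * p) n = if n is n'.+1 then theta (skew_coef p n') else 0.
Proof.
rewrite [LHS]skew_coef_mul; case: n => [|n].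
  by rewrite big_ord1 /skew_coef coefX mul0r.
rewrite big_ord_recl big_ord_recl /= big1 => [|i _].
  by rewrite /skew_coef !coefX /= mul0r add0r mul1r addr0 subn1.
by rewrite /skew_coef coefX /= mul0r.
Qed.

Lemma skewX_C (theta : {rmorphism L -> L}) c :
  skewX theta * skewC theta c = skewC theta (theta c) * skewX theta.
Proof.
apply: skew_eqP => n; rewrite skew_coefXM skew_coefCM.
case: n => [|n]; rewrite /skew_coef coefX ?mulr0 // coefC eqSS.
by case: n => [|n]; rewrite ?mulr1 //= rmorph0 mulr0.
Qed.

Lemma tauMD : {morph @tauM X E d phi : m m' / m + m'}.
Proof. by move=> m m'; rewrite /tauM scalerDr. Qed.

Lemma tauM_scale r (m : M) : tauM (r *: m) = twist 1 r *: tauM m.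
Proof.
move: r; apply: LA_ext => [r r'|r r'|l a].
- by rewrite scalerDl tauMD.
- by rewrite rmorphD scalerDl.
rewrite twist_tens; apply/rowP => k.
rewrite motive_tens_scale /tauM [tens E l a *: m]motive_tens_scale.
by rewrite scalerA skewX_C -scalerA -scalemxAl.
Qed.

Lemma tauM_inj : injective (@tauM X E d phi).
Proof.
move=> m m' /rowP e; apply/rowP => k; apply: skew_eqP => n.
have := congr1 (fun p => skew_coef p n.+1) (e k); rewrite !mxE !skew_coefXM.
exact: fmorph_inj.
Qed.

Lemma skew_coef_sum (theta : {rmorphism L -> L}) (I : Type) (r : seq I) (P : pred I)
    (F : I -> skewpoly theta) n :
  skew_coef (\sum_(j <- r | P j) F j) n = \sum_(j <- r | P j) skew_coef (F j) n.
Proof.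
apply: (big_morph (fun p => skew_coef p n)) => [x y|]; first exact: skew_coefD.
exact: coef0.
Qed.

Lemma coef_iter_skewX (theta : {rmorphism L -> L}) i (l k : 'I_d) n :
  skew_coef (iter i (fun m : 'rV[skewpoly theta]_d => skewX theta *: m)
    (delta_mx 0 l) 0 k) n = ((k == l) && (n == i))%:R.
Proof.
elim: i n => [|i IH] n /=.
  rewrite mxE eqxx /=; case: eqP => _; rewrite /skew_coef ?coef1 ?coef0 //=.
rewrite mxE skew_coefXM; case: n => [|n]; first by rewrite andbF.
by rewrite IH rmorph_nat eqSS.
Qed.

Lemma motive_row a k N : (forall l, (size (phi a k l : {poly L}) <= N)%N) ->
  tens E 1 a *: gM phi k =
  \sum_(i < N) \sum_l
    tens E (mx_coef (phi a) i k l) 1 *: iter i (@tauM X E d phi) (gM phi l).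
Proof.
move=> hN; apply/rowP => l; apply: skew_eqP => n.
rewrite motive_tens_scale mxE skew_coefCM mul1r -rowE mxE.
rewrite summxE skew_coef_sum.
have -> : \sum_(i < N) skew_coef ((\sum_j tens E (mx_coef (phi a) i k j) 1 *:
      iter i (@tauM X E d phi) (gM phi j) : 'rV[Ltau E]_d) 0 l) n =
    \sum_(i < N) if (i == n :> nat) then skew_coef (phi a k l) i else 0.
  apply: eq_bigr => i _; rewrite summxE skew_coef_sum (bigD1 l) //= big1 ?addr0.
    rewrite motive_tens_scale rmorph1 mulmx1 mxE skew_coefCM mxE.
    rewrite [X in _ * X]coef_iter_skewX eqxx /= eq_sym.
    by case: eqP; rewrite ?mulr1 ?mulr0.
  move=> j /negPf jl; rewrite motive_tens_scale rmorph1 mulmx1 mxE skew_coefCM mxE.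
  by rewrite [X in _ * X]coef_iter_skewX eq_sym jl mulr0.
have [nN|Nn] := ltnP n N.
  rewrite (bigD1 (Ordinal nN)) //= eqxx big1 ?addr0 // => i /eqP ni.
  by case: eqP => // e; case: ni; exact: val_inj.
rewrite big1 => [|i _]; last by rewrite ltn_eqF // (leq_trans (ltn_ord i)).
by rewrite /skew_coef nth_default // (leq_trans (hN l)).
Qed.

Lemma delta0D : {morph @delta0 X E d phi : m m' / m + m'}.
Proof. by move=> m m'; apply/colP => k; rewrite !mxE skew_coefD. Qed.

Lemma delta00 : @delta0 X E d phi 0 = 0.
Proof. by apply: (addrI (@delta0 X E d phi 0)); rewrite -delta0D !addr0. Qed.

Lemma delta0_tau (m : M) : delta0 (tauM m) = 0.
Proof. by apply/colP => k; rewrite !mxE skew_coefXM. Qed.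

Lemma skew_coef_mul0 (theta : {rmorphism L -> L}) (p r : skewpoly theta) :
  skew_coef (p * r) 0 = skew_coef p 0 * skew_coef r 0.
Proof. by rewrite [LHS]skew_coef_mul big_ord1. Qed.

Lemma delta0_scale l a (m : M) :
  delta0 (tens E l a *: m) = l *: ((mx_coef (phi a) 0)^T *m delta0 m).
Proof.
apply/colP => k; rewrite !mxE motive_tens_scale !mxE skew_coefCM; congr (_ * _).
rewrite skew_coef_sum; apply: eq_bigr => j _.
by rewrite skew_coef_mul0 !mxE mulrC.
Qed.

Lemma tauQ_balanced : balanced (fun (r : LA E) (m : M) => r *: m)
  (fun (r : LA E) (f : Q) => frac_map Q r * f)
  (fun m f => @extQ_pure (LA E) Q M (tauM m) (frac_ext (twist 1) f)).
Proof.
have tinj := can_inj (@twistK X E 1).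
split=> [f m m'|m f g|r m f].
- by rewrite tauMD extQ_pureDl.
- by rewrite (frac_extD tinj) extQ_pureDr.
- by rewrite (frac_extM tinj) (frac_ext_map Q tinj) tauM_scale extQ_pureZ.
Qed.

Lemma tauQ_pure m f :
  tauQ (@extQ_pure _ Q M m f) = extQ_pure (tauM m) (frac_ext (twist 1) f).
Proof. exact: tensor_lift_pure tauQ_balanced _ _. Qed.

Lemma tauQ_pure1 m : tauQ (pure m) = pure (tauM m).
Proof.
rewrite tauQ_pure -(rmorph1 (frac_map Q)) frac_ext_map ?rmorph1 //.
exact: can_inj (@twistK X E 1).
Qed.

Lemma tauQD : {morph @tauQ X E d phi Q : x y / x + y}.
Proof. exact: tensor_liftD tauQ_balanced. Qed.

Lemma tauQ_scale r x : tauQ (frac_map Q r *: x) = frac_map Q (twist 1 r) *: tauQ (x : MQ).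
Proof.
have tinj := can_inj (@twistK X E 1).
move: x; apply: tensor_ext => [x y|x y|m f]; rewrite ?scalerDr ?tauQD ?scalerDr //.
rewrite -[tensor_pure _ _ m f]/(extQ_pure m f) extQ_scaleE !tauQ_pure extQ_scaleE.
by rewrite (frac_extM tinj) (frac_ext_map Q tinj).
Qed.

Context (Mgen : is_fin_gen M) (Mproj : is_projective M).

Let pure_inj := @extQ_pure_inj _ Q _ Mgen Mproj.

Lemma tauQ_inj : injective (@tauQ X E d phi Q).
Proof.
have tinj := can_inj (@twistK X E 1).
move=> x y e; apply/eqP; rewrite -subr_eq0; apply/eqP.
have [m [s [s0 exy]]] := extQ_repr (x - y).
have : tauQ (frac_map Q s *: (x - y)) = 0.
  rewrite tauQ_scale (_ : tauQ (x - y) = 0) ?scaler0 //.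
  by apply: (addIr (tauQ y)); rewrite -tauQD subrK e add0r.
have fs := frac_map_neq0 Q s0.
rewrite exy extQ_scaleE divff // tauQ_pure1 -(@extQ_pure0 _ Q M 1) => /pure_inj tm0.
have m0 : m = 0 by apply: tauM_inj; rewrite tm0 /tauM scaler0.
by rewrite m0 !extQ_pure0.
Qed.

Section TauInverse.
Context (w : LA E) (n0 : nat) (w0 : w != 0) (Jw : ideal_pow (Jideal E 0) n0 w).
Context (JnM_tau : ideal_mul (ideal_pow (Jideal E 0) n0) [set: M]
  `<=` range (@tauM X E d phi)).

Lemma scale_w_tau (m : M) : exists m', w *: m = tauM m'.
Proof.
suff [m' _ <-] : range (@tauM X E d phi) (w *: m) by exists m'.
by apply: JnM_tau; apply: sub_add_span; exists w, m.
Qed.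

(** As [w m = tau m'], the element [m / s] equals [tau m' / (s w)], the image of [m'] divided by the
    untwisted denominator. *)
Lemma tauQ_surj x : exists y, tauQ y = x :> MQ.
Proof.
have [m [s [s0 ->]]] := extQ_repr x; have [m' e] := scale_w_tau m.
have tinj := can_inj (@twistK X E 1).
have sw := frac_mul_neq0 Q s0 w0.
have ts0 : twist (-1) (s * w) != 0.
  by apply: contra_neq sw => h; rewrite -[s * w](@twistK X E (-1)) h rmorph0.
exists (extQ_pure m' (frac_map Q (twist (-1) (s * w)))^-1).
rewrite tauQ_pure -[X in frac_ext _ X]mul1r -(rmorph1 (frac_map Q)).
rewrite (frac_ext_div Q tinj) // !rmorph1 mul1r /= (twistNK 1).
rewrite -e extQ_pureZ rmorphM invfM mulrCA divff ?mulr1 //.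
exact: frac_map_neq0.
Qed.

Local Notation tinv := (@tauQ_inv X E d phi Q).

Lemma tauQ_invK x : tauQ (tinv x) = x.
Proof. by have [y e] := tauQ_surj x; rewrite /tauQ_inv; case: xgetP => // /(_ y). Qed.

Lemma tauQK x : tinv (tauQ x) = x.
Proof. by apply: tauQ_inj; rewrite tauQ_invK. Qed.

Lemma tauQ_invD : {morph tinv : x y / x + y}.
Proof. by move=> x y; apply: tauQ_inj; rewrite tauQD !tauQ_invK. Qed.

Lemma tauQ_inv_scale r x : tinv (frac_map Q r *: x) = frac_map Q (twist (-1) r) *: tinv x.
Proof.
apply: tauQ_inj; rewrite tauQ_scale !tauQ_invK; congr (frac_map Q _ *: _).
exact/esym/(twistNK 1).
Qed.

Lemma iter_tauQ_invD n : {morph iter n tinv : x y / x + y}.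
Proof. by elim: n => // n IH x y; rewrite !iterS IH tauQ_invD. Qed.

Lemma iter_tauQ_inv_sum n (I : finType) (x : I -> MQ) :
  iter n tinv (\sum_i x i) = \sum_i iter n tinv (x i).
Proof.
apply: (big_morph _ (iter_tauQ_invD n)); apply: (addrI (iter n tinv 0)).
by rewrite -iter_tauQ_invD !addr0.
Qed.

Lemma iter_tauQ_inv_scale n r x :
  iter n tinv (frac_map Q r *: x) = frac_map Q (twist (- n%:Z) r) *: iter n tinv x.
Proof.
have -> : - n%:Z = -1 *+ n by rewrite mulNrn natz.
rewrite -iter_twist.
by elim: n => // n IH; rewrite !iterS IH tauQ_inv_scale.
Qed.

Lemma iter_tauQ_inv_tau n i (m : M) : iter n tinv (pure (iter i (@tauM X E d phi) m)) =
  if (i <= n)%N then iter (n - i) tinv (pure m)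
  else pure (iter (i - n) (@tauM X E d phi) m).
Proof.
elim: n i => [|n IH] [|i] //.
by rewrite iterSr [iter i.+1 _ _]iterS -tauQ_pure1 tauQK IH ltnS !subSS.
Qed.

Hypothesis ev_w : forall j : nat, ev_Xi (twist (- j.+1%:Z) w) != 0.

Lemma iter_tauQ_inv_MJ n m : MJ (iter n tinv (pure m)).
Proof.
(* Each application of [tau^-1] costs one factor [w], since [w M] lies in [tau M], and twists the
   factors already present. *)
pose s n := \prod_(j < n) twist (- j.+1%:Z) w.
have [m' e] : exists m', frac_map Q (s n) *: iter n tinv (pure m) = pure m'.
  elim: n => [|n [m' e]]; first by exists m; rewrite /s big_ord0 rmorph1 scale1r.
  have [m'' e'] := scale_w_tau m'; exists m''.
  rewrite /s big_ord_recl /= rmorphM -scalerA.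
  have -> : \prod_(i < n) twist (- (bump 0 i).+1%:Z) w = twist (-1) (s n).
    rewrite rmorph_prod; apply: eq_bigr => j _.
    by rewrite /= twist_twist /bump leq0n; congr (twist _ w); lia.
  rewrite -tauQ_inv_scale e -[LHS]tauQ_inv_scale extQ_frac_scale e' -tauQ_pure1.
  by rewrite tauQK.
have es : ev_Xi (s n) != 0.
  by rewrite rmorph_prod /=; apply/prodf_neq0 => j _; exact: ev_w.
have s0 : s n != 0 by apply: contra_neq es => ->; rewrite rmorph0.
exists m', (s n); split; first by apply/(notJ (@Jideal0E X E)).
have fs := frac_map_neq0 Q s0.
apply: (scalerI fs); rewrite e extQ_scaleE divff //.
Qed.

(** The choice made in [delta0_J] is harmless: two approximations of [x], compared at the smaller
    exponent, differ by an element of [tau M], which [delta0] kills. *)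
Lemma delta0_J_eq x m : JnMJ n0 (x - pure m) -> delta0_J x = delta0 m.
Proof.
move=> hm; rewrite /delta0_J; case: xgetP => [m' _ [n [gn hn]]|/(_ m)]; last first.
  by case; exists n0.
have [p [gp hp hp']] : exists p,
    [/\ ideal_mul (ideal_pow (Jideal E 0) p) [set: M] `<=` range (@tauM X E d phi),
        JnMJ p (x - pure m) & JnMJ p (x - pure m')].
  have [le|/ltnW le] := leqP n n0.
    by exists n; split=> //; exact: JnMJ_leq le _ hm.
  by exists n0; split=> //; exact: JnMJ_leq le _ hn.
have : JnMJ p (pure (m - m')).
  have -> : pure (m - m') = (x - pure m') - (x - pure m).
    by rewrite extQ_pureB opprB [RHS]addrC subrKA.
  by apply: add_spanD => //; exact: (JnMJN (@Jideal0E X E)).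
move=> /(JnMJ_pure (@ev_XiK X E) (@Jideal0E X E) pure_inj) /gp [u _ e].
by rewrite -[m](subrK m') delta0D -e delta0_tau add0r.
Qed.

(** Relational form of [delta0_J] at the fixed exponent [n0]: compatibility with sums and scalars is
    immediate here, whereas [delta0_J] is defined by choice. *)
Definition has_delta0 (x : MQ) (v : 'cV[L]_d) : Prop :=
  exists2 m, JnMJ n0 (x - pure m) & v = delta0 m.

Lemma has_delta0_unique x v : has_delta0 x v -> delta0_J x = v.
Proof. by move=> [m hm ->]; exact: delta0_J_eq. Qed.

Lemma has_delta0_J x : MJ x -> has_delta0 x (delta0_J x).
Proof.
move=> /(MJ_approx (@ev_XiK X E) (@Jideal0E X E) n0) [m hm].
by exists m => //; exact: delta0_J_eq.
Qed.

Lemma has_delta0_pure m : has_delta0 (pure m) (delta0 m).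
Proof. by exists m => //; rewrite subrr; exact: add_span0. Qed.

Lemma has_delta0D x y v v' :
  has_delta0 x v -> has_delta0 y v' -> has_delta0 (x + y) (v + v').
Proof.
move=> [m hm ->] [m' hm' ->]; exists (m + m'); last by rewrite delta0D.
by rewrite extQ_pureDl opprD addrACA; exact: add_spanD.
Qed.

Lemma has_delta0_sum (I : finType) (x : I -> MQ) v :
  (forall i, has_delta0 (x i) (v i)) -> has_delta0 (\sum_i x i) (\sum_i v i).
Proof.
move=> h; apply: (big_ind2 has_delta0) => // [|x1 v1 x2 v2]; last exact: has_delta0D.
exists 0; first by rewrite extQ_pure0 subrr; exact: add_span0.
exact/esym/delta00.
Qed.

Lemma has_delta0_scale l a x v : has_delta0 x v ->
  has_delta0 (frac_map Q (tens E l a) *: x) (l *: ((mx_coef (phi a) 0)^T *m v)).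
Proof.
move=> [m hm ->]; exists (tens E l a *: m); last by rewrite delta0_scale.
by rewrite -extQ_frac_scale -scalerBr; exact: (JnMJZ (@Jideal0E X E)).
Qed.

Lemma mx_coef_phi1 : mx_coef (phi 1) 0 = 1%:M.
Proof.
apply/matrixP => k l; rewrite rmorph1 !mxE.
by case: eqP; rewrite /skew_coef ?coef1 ?coef0.
Qed.

Lemma has_delta0_scaleL l x v : has_delta0 x v ->
  has_delta0 (frac_map Q (tens E l 1) *: x) (l *: v).
Proof. by move=> /(@has_delta0_scale l 1); rewrite mx_coef_phi1 trmx1 mul1mx. Qed.

(* Row [k] is [delta_0 (tau^-n g_k)^T]; the coefficient [Q_n] of the exponential *)
(* is the n-th twist of this matrix.                                             *)
Definition tau_inv_mx n : 'M[L]_d :=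
  \matrix_(k, l) delta0_J (iter n tinv (pure (gM phi k))) l 0.

Lemma tau_inv_mx0 : tau_inv_mx 0 = 1%:M.
Proof.
apply/matrixP => k l; rewrite mxE /= (has_delta0_unique (has_delta0_pure _)) !mxE.
by rewrite eqxx eq_sym /=; case: eqP; rewrite /skew_coef ?coef1 ?coef0.
Qed.

(** Two evaluations of [delta_0(a . tau^-n g_k)]: [h1] uses that [a] acts on the target of [delta_0]
    through the transpose of [d[a]]; [h2] expands [a g_k] in the [tau^i g_l], where [tau^-n] twists
    the coefficients by [-n]. *)
Lemma tau_inv_mx_rel a n : tau_inv_mx n *m mx_coef (phi a) 0 =
  \sum_(i < n.+1) map_mx (qpow (- n%:Z)) (mx_coef (phi a) i) *m tau_inv_mx (n - i).
Proof.
pose v l i : 'cV[L]_d :=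
  if (i <= n)%N then delta0_J (iter (n - i) tinv (pure (gM phi l))) else 0.
have hv l i : has_delta0 (iter n tinv (pure (iter i (@tauM X E d phi) (gM phi l)))) (v l i).
  rewrite iter_tauQ_inv_tau /v; case: leqP => hi.
    by apply: has_delta0_J; exact: iter_tauQ_inv_MJ.
  have := has_delta0_pure (iter (i - n) (@tauM X E d phi) (gM phi l)).
  by rewrite -(prednK (_ : 0 < i - n)%N) ?subn_gt0 // iterS delta0_tau.
apply/row_matrixP => k; apply: trmx_inj.
have h1 : has_delta0 (frac_map Q (tens E 1 a) *: iter n tinv (pure (gM phi k)))
    ((mx_coef (phi a) 0)^T *m delta0_J (iter n tinv (pure (gM phi k)))).
  rewrite -[X in has_delta0 _ X]scale1r; apply: has_delta0_scale.
  by apply: has_delta0_J; exact: iter_tauQ_inv_MJ.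
(* The range [n.+1 + e] covers all coefficients of row [k] of [phi a] and splits at [n.+1]; indices
   above [n] contribute elements of [tau M], hence zero. *)
pose e := \max_l size (phi a k l : {poly L}).
have h2 : has_delta0 (frac_map Q (tens E 1 a) *: iter n tinv (pure (gM phi k)))
    (\sum_(i < n.+1 + e) \sum_l qpow (- n%:Z) (mx_coef (phi a) i k l) *: v l i).
  have -> : frac_map Q (tens E 1 a) *: iter n tinv (pure (gM phi k)) =
     \sum_(i < n.+1 + e) \sum_l frac_map Q (tens E (qpow (- n%:Z) (mx_coef (phi a) i k l)) 1)
       *: iter n tinv (pure (iter i (@tauM X E d phi) (gM phi l))).
    have h1a : tens E 1 a = twist (- n%:Z) (tens E 1 a) by rewrite twist_tens rmorph1.
    rewrite [in LHS]h1a -iter_tauQ_inv_scale extQ_frac_scale (@motive_row a k (n.+1 + e)).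
      rewrite extQ_pure_sum iter_tauQ_inv_sum; apply: eq_bigr => i _.
      rewrite extQ_pure_sum iter_tauQ_inv_sum; apply: eq_bigr => l _.
      by rewrite -extQ_frac_scale iter_tauQ_inv_scale twist_tens.
    move=> l; apply: leq_trans (leq_addl _ _).
    exact: (leq_bigmax (F := fun l => size (phi a k l : {poly L}))).
  by apply: has_delta0_sum => i; apply: has_delta0_sum => l; exact: has_delta0_scaleL.
have := has_delta0_unique h1; rewrite (has_delta0_unique h2) => e12.
rewrite row_mul trmx_mul -[_ *m _]/(_ *m _).
have -> : (row k (tau_inv_mx n))^T = delta0_J (iter n tinv (pure (gM phi k))).
  by apply/colP => l; rewrite 3!mxE.
rewrite -e12 big_split_ord /= [X in _ + X]big1 ?addr0; last first.
  move=> i _; rewrite big1 // => l _; rewrite /v leqNgt addSn ltnS leq_addr /=.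
  exact: scaler0.
apply/colP => l; rewrite 2![in RHS]mxE !summxE; apply: eq_bigr => i _.
rewrite summxE mxE; apply: eq_bigr => j _.
rewrite 2![in LHS]mxE 2![in RHS]mxE /v -ltnS ltn_ord.
by rewrite [in RHS]mxE.
Qed.

End TauInverse.

End Motive.

(** * The exponential series *)

Section Tangent.
Context {X : pointed_curve} {E : coef_field X} {d : nat} (phi : anderson_module E d).
Local Notation L := (L E).
Local Notation A := (Aring X).
Local Notation q := #|Fq X|.

Lemma card_Fq_gt1 : (1 < q)%N. Proof. exact: finNzRing_gt1. Qed.

Lemma powq_add_nilpotent (t : L) (N : 'M[L]_d) n : N ^+ n = 0 ->
  (t%:M + N) ^+ (q ^ n) = (t ^+ (q ^ n))%:M.
Proof.
case: d N => [|d'] N N0; first by apply/matrixP => - [].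
have pP : [pchar {poly L}].-nat (q ^ n)%N.
  by rewrite (eq_pnat _ (pchar_poly L)); exact: pchar_q.
(* The Frobenius identity is taken in the commutative ring [{poly L}] and evaluated at [N]. *)
have := congr1 (horner_mx N) (exprDn_pchar t%:P 'X pP).
rewrite rmorphXn !rmorphD !rmorphXn /= horner_mx_X horner_mx_C => ->.
have -> : N ^+ (q ^ n) = 0.
  have le_n : (n <= q ^ n)%N by apply: ltnW; exact: ltn_expl card_Fq_gt1.
  by rewrite -(subnK le_n) exprD N0 mulr0.
by rewrite addr0 -rmorphXn.
Qed.

Lemma mx_coef_phiX a n : mx_coef (phi (a ^+ n)) 0 = mx_coef (phi a) 0 ^+ n.
Proof.
elim: n => [|n IH]; first by rewrite !expr0 mx_coef_phi1.
rewrite !exprS -IH rmorphM; apply/matrixP => k l; rewrite !mxE skew_coef_sum.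
by apply: eq_bigr => j _; rewrite skew_coef_mul0 !mxE.
Qed.

Lemma exists_scalar_tangent a :
  exists n, mx_coef (phi (a ^+ (q ^ n))) 0 = (A_to_L E (a ^+ (q ^ n)))%:M.
Proof.
have [N [n N0] e] := am_tangent phi a; exists n.
by rewrite mx_coef_phiX e powq_add_nilpotent // A_to_LX.
Qed.

(** Otherwise A reduces to the constants, L (x) A acts through L alone, and finitely many generators
    bound the tau-degree, contradicting [tau^D g_k] in M. *)
Lemma exists_transcendental : (0 < d)%N -> is_fin_gen (motive phi) ->
  exists a : A, ~ algebraicOver (Fq_to_K X) (A_val a).
Proof.
move=> d0 [n [e he]]; apply: contrapT => nex; pose k := Ordinal d0.
have constA (a : A) : exists c, a = iotaA c.
  have [c hc] : exists c, A_val a = Fq_to_K X c.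
    apply: Kf_constants; apply: contrapT => na; apply: nex; by exists a.
  by exists c; apply: val_inj.
pose D := \max_i size ((e i : 'rV[Ltau E]_d) 0%R k : {poly L}).
have coef_e (r : LA E) i : skew_coef ((r *: e i : 'rV[Ltau E]_d) 0 k) D = 0.
  move: r; apply: tensor_ind => [|l a|r r' hr hr'].
  - by rewrite scale0r mxE /skew_coef coef0.
  - have [c ->] := constA a; have [_ _ hb] := tens_balanced E.
    have -> : tensor_pure _ _ l (iotaA c) = tens E (iotaL E c * l) 1.
      by rewrite hb mulr1.
    rewrite motive_tens_scale rmorph1 mulmx1 mxE skew_coefCM.
    rewrite [X in _ * X]nth_default ?mulr0 //.
    exact: (leq_bigmax (F := fun i => size ((e i : 'rV[Ltau E]_d) 0%R k : {poly L}))).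
  - by rewrite scalerDl mxE skew_coefD hr hr' addr0.
have [c hc] := he (iter D (@tauM X E d phi) (gM phi k)).
have : skew_coef ((iter D (@tauM X E d phi) (gM phi k) : 'rV[Ltau E]_d) 0 k) D = 1.
  by rewrite [LHS]coef_iter_skewX !eqxx.
rewrite hc summxE skew_coef_sum.
rewrite big1 => [/esym/eqP|i _]; first by rewrite oner_eq0.
exact: coef_e.
Qed.

End Tangent.

Lemma abs_Cinf_is_abs (X : pointed_curve) (E : coef_field X) : is_abs (abs_Cinf E).
Proof. by have [] := Cinf_completion E. Qed.

Lemma abs_transcendental_gt1 (X : pointed_curve) (E : coef_field X) (a : Aring X) :
  ~ algebraicOver (Fq_to_K X) (A_val a) -> 1 < abs_Cinf E (L_to_Cinf E (A_to_L E a)).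
Proof.
move=> ta; have va := regular_away_pole (A_valP a) ta.
have [_ _ hC _] := Cinf_completion E; have [_ _ hK _] := Kinf_completion E.
rewrite /A_to_L K_L_Cinf hC Kbar_abs_ext hK /abs_infty; case: eqP => [a0|_].
  by case: ta; rewrite a0; exact: algebraic0.
case: (ord_infty X (A_val a)) va => // m _; rewrite NegzE opprK.
by rewrite -exprnP exprn_egt1 // ltr1n card_Fq_gt1.
Qed.

(** * Functional equation and uniqueness of the exponential; terms of the pairing *)

Section Exponential.
Context {X : pointed_curve} {E : coef_field X} {d : nat} (phi : anderson_module E d).
Local Notation L := (L E).
Local Notation A := (Aring X).
Local Notation C := (Cinf E).
Local Notation q := #|Fq X|.
Local Notation powq n := (fun x : C => x ^+ (q ^ n)).

Lemma map_powq_L p r (B : 'M[L]_(p, r)) n :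
  map_mx (powq n) (map_mx (L_to_Cinf E) B) = map_mx (L_to_Cinf E) (map_mx (qpow n%:Z) B).
Proof. by apply/matrixP => k l; rewrite !mxE rmorphXn. Qed.

Lemma map_powq0 p r n : map_mx (powq n) (0 : 'M[C]_(p, r)) = 0.
Proof. by apply/matrixP => k l; rewrite !mxE expr0n -leqn0 leqNgt q_gt0. Qed.

Lemma ts_comp_const P (D : 'M[C]_d) n : ts_comp P (ts_const D) n = P n *m map_mx (powq n) D.
Proof.
rewrite /ts_comp big_ord_recr /= subnn /ts_const eqxx big1 ?add0r // => i _.
by rewrite subn_eq0 leqNgt ltn_ord /= map_powq0 mulmx0.
Qed.

(** The term [i = 0] on the right of the functional equation is [t *: P n] and moves to the left;
    this is the hypothesis [hQ] of the decay estimate. *)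
Lemma exp_recursion P (a : A) (t : L) n : is_exp_series phi P ->
  mx_coef (phi a) 0 = t%:M ->
  (L_to_Cinf E t ^+ (q ^ n) - L_to_Cinf E t) *: P n =
  \sum_(i < n) ts_phi phi a i.+1 *m map_mx (powq i.+1) (P (n - i.+1)%N).
Proof.
move=> [_ /(_ a n)]; rewrite ts_comp_const /ts_comp big_ord_recl subn0 /=.
rewrite /ts_phi => e ha; move: e; rewrite ha map_powq_L !map_scalar_mx /= expn0.
rewrite mul_mx_scalar mul_scalar_mx rmorphXn scalerBl => ->.
rewrite (_ : map_mx _ (P n) = P n); last by apply/matrixP => k l; rewrite mxE expr1.
by rewrite addrAC subrr add0r.
Qed.

(** The recursion determines [P n] from earlier coefficients, because [t ^+ (q ^ n) - t] is nonzero
    when [t] has absolute value above 1. *)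
Lemma exp_series_unique (a : A) (t : L) P P' : mx_coef (phi a) 0 = t%:M ->
  1 < abs_Cinf E (L_to_Cinf E t) ->
  is_exp_series phi P -> is_exp_series phi P' -> P = P'.
Proof.
move=> ha t1 hP hP'; apply/funext => n; elim/ltn_ind: n => n IH.
have [->|n0] := posnP n; first by rewrite hP.1 hP'.1.
have := exp_recursion n hP ha; rewrite (eq_bigr (fun i : 'I_n =>
   ts_phi phi a i.+1 *m map_mx (powq i.+1) (P' (n - i.+1)%N))); last first.
  by move=> i _; rewrite IH // ltn_subrL.
rewrite -(exp_recursion n hP' ha); apply: scalerI; apply/eqP => h0.
have qn1 : (1 < q ^ n)%N by rewrite -{1}(exp1n n) ltn_exp2r // card_Fq_gt1.
have := abs_frob_sub (abs_Cinf_is_abs E) t1 qn1.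
rewrite h0 (abs0 (abs_Cinf_is_abs E)) leNgt exprn_gt0 //.
exact: lt_trans ltr01 t1.
Qed.

Context (Q : frac_field (LA E)).

Definition exp_coef n : 'M[C]_d :=
  map_mx (L_to_Cinf E) (map_mx (qpow n%:Z) (tau_inv_mx Q phi n)).

Lemma map_qpowD (i j : int) p r (B : 'M[L]_(p, r)) :
  map_mx (qpow i) (map_mx (qpow j) B) = map_mx (qpow (i + j)) B.
Proof. by apply/matrixP => k l; rewrite !mxE qpowD. Qed.

Lemma map_qpow0 p r (B : 'M[L]_(p, r)) : map_mx (qpow 0) B = B.
Proof. by apply/matrixP => k l; rewrite !mxE qpow0. Qed.

(** The n-th twist turns [A_{a,i}^(-n)] into [A_{a,i}] and [B_(n-i)] into the i-th twist of
    [exp_coef (n - i)]. *)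
Lemma exp_coef_series :
  tau_inv_mx Q phi 0 = 1%:M ->
  (forall a n, tau_inv_mx Q phi n *m mx_coef (phi a) 0 =
    \sum_(i < n.+1) map_mx (qpow (- n%:Z)) (mx_coef (phi a) i) *m tau_inv_mx Q phi (n - i)) ->
  is_exp_series phi exp_coef.
Proof.
move=> h0 h; split=> [|a n]; first by rewrite /exp_coef h0 !map_scalar_mx !rmorph1.
rewrite ts_comp_const /ts_phi map_powq_L /exp_coef -!map_mxM h !raddf_sum /=.
apply: eq_bigr => i _; rewrite map_powq_L map_qpowD !map_mxM map_qpowD addrN map_qpow0.
have -> : i%:Z + (n - i)%:Z = n by rewrite -PoszD subnKC // -ltnS.
by [].
Qed.

Lemma LAtau_act1 (m : motive phi) : LAtau_act 1 m = m.
Proof.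
by rewrite /LAtau_act size_poly1 big_ord1 /skew_coef coef1 scale1r.
Qed.

Lemma LAsigma_act1 (n : dual_motive phi) : LAsigma_act 1 n = n.
Proof.
by rewrite /LAsigma_act size_poly1 big_ord1 /skew_coef coef1 scale1r.
Qed.

Lemma F_series11 z j : F_series phi Q 1 1 z j = (tau_inv_mx Q phi j *m z)^T.
Proof.
apply/rowP => l; rewrite /F_series summxE big_ord_recr /= big1 ?add0r.
  rewrite mxE /F_summand summxE skew_coef_sum (bigD1 l) //= big1 ?addr0.
    rewrite mxE skew_coefCM LAsigma_act1 [X in _ * X]coef_iter_skewX !eqxx mulr1.
    rewrite LAtau_act1 2!mxE [in RHS]mxE; apply: eq_bigr => k _.
    by rewrite mxE [in RHS]mxE.
  move=> k /negPf kl; rewrite mxE skew_coefCM LAsigma_act1 [X in _ * X]coef_iter_skewX.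
  by rewrite eq_sym kl mulr0.
move=> i _; rewrite mxE /F_summand summxE skew_coef_sum big1 // => k _.
rewrite mxE skew_coefCM LAsigma_act1 [X in _ * X]coef_iter_skewX.
by rewrite gtn_eqF ?ltn_ord // andbF mulr0.
Qed.

Lemma sigma_term_F z n : sigma_term (F_series phi Q 1 1 z) n =
  exp_coef n *m map_mx (powq n) (map_mx (L_to_Cinf E) z).
Proof.
rewrite map_powq_L /exp_coef -!map_mxM; apply/colP => k.
by rewrite mxE F_series11 [in RHS]mxE [in RHS]mxE [in LHS]mxE.
Qed.

End Exponential.

Theorem theorem3p7 (X : pointed_curve) (E : coef_field X)
    (Q : frac_field (LA E)) (d r : nat) (phi : anderson_module E d)
    (hab : is_abelian_motive phi Q r)
    (hfin : is_A_finite_dual_motive phi Q r)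
    (hXi : Xi_regular phi Q r)
    (z : 'cV[L E]_d) :
  in_N_sigma (F_series phi Q 1 1 z) /\
  F_pairing phi Q 1 1 z = Exp phi (map_mx (L_to_Cinf E) z).
Proof.
have [d0|d_gt0] := posnP d.
  by subst d; split=> [[]//|]; apply/colP => - [].
have [Mgen Mproj _ [n0 /(_ n0 (leqnn n0)) JnM_tau]] := hab.
have [a ta] := exists_transcendental d_gt0 Mgen.
have a1 := abs_transcendental_gt1 E ta.
have habs := abs_Cinf_is_abs E.
have q1 := @card_Fq_gt1 X.
have frob_neq j : A_to_L E a ^+ (#|Fq X| ^ j.+1) != A_to_L E a.
  apply/eqP => e; have qn1 : (1 < #|Fq X| ^ j.+1)%N by rewrite -{1}(exp1n j.+1) ltn_exp2r.
  have := abs_frob_sub habs a1 qn1; rewrite -rmorphXn e subrr (abs0 habs) leNgt.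
  by rewrite exprn_gt0 // (lt_trans ltr01 a1).
(* The value of [w^(-j-1)] at Xi is [(a - a^(q^(-j-1)))^n0], nonzero by [frob_neq]. *)
pose w := (tens E 1 a - tens E (A_to_L E a) 1) ^+ n0.
have ev_w j : ev_Xi (twist (- j.+1%:Z) w) != 0.
  rewrite !rmorphXn !rmorphB /= !twist_tens rmorph1 !ev_Xi_tens A_to_L1 mulr1 mul1r.
  rewrite expf_neq0 // subr_eq0; apply: contra_neq (frob_neq j) => e.
  by rewrite [in LHS]e -[_ ^+ _]/(qpow j.+1%:Z _) qpowD addrN qpow0.
have w0 : w != 0 by apply: contra_neq (ev_w 0%N) => ->; rewrite !rmorph0.
have Jw : ideal_pow (Jideal E 0) n0 w.
  apply: ideal_powX; apply/Jideal0E.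
  by rewrite rmorphB /= !ev_Xi_tens A_to_L1 mulr1 mul1r subrr.
have expP : is_exp_series phi (exp_coef phi Q).
  apply: exp_coef_series; first exact: (tau_inv_mx0 Q Mgen Mproj JnM_tau).
  exact: (tau_inv_mx_rel Q Mgen Mproj w0 Jw JnM_tau ev_w).
(* Passing to a q-power of [a] kills the nilpotent part of the tangent action and keeps the absolute
   value above 1. *)
have [e he] := exists_scalar_tangent phi a.
set b := a ^+ _ in he.
have b1 : 1 < abs_Cinf E (L_to_Cinf E (A_to_L E b)).
  by rewrite /b A_to_LX rmorphXn (absX habs) exprn_egt1 // -lt0n q_gt0.
split.
  move=> k; pose D := \max_(p : 'I_d * 'I_d) size (phi b p.1 p.2 : {poly L E}).
  rewrite mxE (_ : (fun n => _) = (fun n => (exp_coef phi Q n *m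
    map_mx (fun x => x ^+ (#|Fq X| ^ n)) (map_mx (L_to_Cinf E) z)) k 0)); last first.
    by apply/funext => n; rewrite sigma_term_F.
  apply: (recursion_entire habs (D := D) q1 b1 (A := ts_phi phi b)) => [i Di|n _].
    apply/matrixP => k' l; rewrite !mxE /skew_coef nth_default ?rmorph0 //.
    apply: leq_trans (ltnW Di).
    exact: (leq_bigmax (F := fun p : 'I_d * 'I_d => size (phi b p.1 p.2 : {poly L E})) (k', l)).
  exact: exp_recursion expP he.
(* The two series agree term by term, so their sums agree; uniqueness handles the series chosen
   inside [Exp], and [expP] excludes its default value. *)
rewrite /F_pairing /delta1 /Exp; congr vec_series; apply/funext => n.
rewrite sigma_term_F; congr (_ n *m _); case: xgetP => [P _ hP|/(_ _ expP) //].
exact: exp_series_unique he b1 expP hP.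
Qed.
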